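(* (1) Let $\sigma\in S_n$ have cycle type corresponding to a ''homogeneous'' partition of $n$, that is $n=k+\dots+k$ (with $\alpha_k$ summands), for some $k,\alpha_k\ge1$. Then $$\mathfrak{pvb}_{n,\sigma}^!(z)=\mathfrak{pvb}_{\alpha_k}^!\big((-1)^{k-1}k\,z^k\big)=\sum_{0\le\beta\le\alpha_k}L(\alpha_k,\beta)\,(-1)^{(\alpha_k-\beta)(k-1)}\,k^{\alpha_k-\beta}\,z^{(\alpha_k-\beta)k}.$$ (2) Let $\sigma\in S_n$ have cycle type corresponding to a non-homogeneous partition $n=\sum_{i=1}^r i\,\alpha_i$ (with $\alpha_i\ge0$ cycles of length $i$). Put $n_i=i\alpha_i$ for $i=1,\dots,r$, and denote by $\mathfrak{pvb}_{n_i,i\alpha_i}^!(z)$ the character given in (1) for the homogeneous partition $n_i=i+\dots+i$ ($\alpha_i$ summands), interpreted as $1$ if $\alpha_i=0$. Then $$\mathfrak{pvb}_{n,\sigma}^!(z)=\prod_{i=1}^r\mathfrak{pvb}_{n_i,i\alpha_i}^!(z).$$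
   Context: $\mathfrak{pvb}_n^!$ is the exterior algebra over $\mathbb{Q}$ on degree-1 generators $r_{ij}$, $1\le i\neq j\le n$, modulo the relations, for distinct $i,j,k$: $r_{ij}\wedge r_{ik}=r_{ij}\wedge r_{jk}-r_{ik}\wedge r_{kj}$, $r_{ik}\wedge r_{jk}=r_{ij}\wedge r_{jk}-r_{ji}\wedge r_{ik}$, $r_{ij}\wedge r_{ji}=0$. It is known to be isomorphic to $H^*(PvB_n,\mathbb{Q})$, where $PvB_n$ is the pure virtual braid group, generated by $R_{ij}$, $1\le i\ne j\le n$, with relations $R_{ij}R_{ik}R_{jk}=R_{jk}R_{ik}R_{ij}$ and $R_{ij}R_{kl}=R_{kl}R_{ij}$ for distinct $i,j,k,l$. $S_n$ acts on $\mathfrak{pvb}_n^!$ by $\sigma(r_{ij})=r_{\sigma(i)\sigma(j)}$. For $\sigma\in S_n$, $\mathfrak{pvb}_{n,\sigma}^{!k}$ is the trace of $\sigma$ on the degree-$k$ component, and $\mathfrak{pvb}_{n,\sigma}^!(z)=\sum_{k\ge0}\mathfrak{pvb}_{n,\sigma}^{!k}z^k$. $\mathfrak{pvb}_m^!(z)$ is the Hilbert series of dimensions of $\mathfrak{pvb}_m^!$, known to equal $\sum_{\beta=0}^m L(m,\beta)z^{m-\beta}$ (and $\mathfrak{pvb}_1^!=\mathbb{Q}$, $\mathfrak{pvb}_1^!(z)=1$). $L(p,q)$ are the Lah numbers: the number of unordered partitions of $\{1,\dots,p\}$ into $q$ nonempty (linearly) ordered subsets. *)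

(* Defs.v *)
From HB Require Import structures.
From mathcomp Require Import all_boot all_order all_algebra all_fingroup all_field.
From mathcomp Require Import ring.

Set Implicit Arguments.
Unset Strict Implicit.
Unset Printing Implicit Defensive.

Import GRing.Theory.

Local Open Scope ring_scope.

Section PairProduct.

Variable G : eqType.
Implicit Types (h : G -> G -> rat) (s t : seq G).

(* The product of h (s_i) (s_j) over all positions i < j of s. *)
Fixpoint pair_prod h s : rat :=
  if s is a :: s' then (\prod_(b <- s') h a b) * pair_prod h s' else 1.

Lemma pair_prod_cat h s t :
  pair_prod h (s ++ t) =
  pair_prod h s * (\prod_(a <- s) \prod_(b <- t) h a b) * pair_prod h t.
Proof.
elim: s => [|a s IH] /=; first by rewrite big_nil !mul1r.
by rewrite IH big_cat big_cons /=; ring.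
Qed.

Lemma pair_prodM h h' s :
  pair_prod (fun a b => h a b * h' a b) s = pair_prod h s * pair_prod h' s.
Proof. by elim: s => [|a s IH] /=; rewrite ?mulr1 // IH big_split /=; ring. Qed.

Lemma pair_prod_perm h s t :
  (forall a b, h a b = h b a) -> perm_eq s t -> pair_prod h s = pair_prod h t.
Proof.
move=> hC; apply: catCA_perm_subst => s1 s2 s3.
rewrite !pair_prod_cat; under eq_bigr do rewrite big_cat /=.
under [in RHS]eq_bigr do rewrite big_cat /=.
rewrite !big_split exchange_big /=.
under eq_bigr do under eq_bigr do rewrite hC.
ring.
Qed.

End PairProduct.

Lemma pair_prod_map (G H : eqType) (g : H -> G) h (s : seq H) :
  pair_prod h (map g s) = pair_prod (fun a b => h (g a) (g b)) s.
Proof. by elim: s => //= a s ->; rewrite big_map. Qed.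

(* The exterior algebra over rat on a finite set G of generators, on the basis
   e_S, S : {set G}, where e_S is the wedge of the elements of S taken in the
   order of enum G. *)
Definition exterior (G : finType) : Type := {ffun {set G} -> rat^o}.

HB.instance Definition _ (G : finType) :=
  Vector.copy (exterior G) {ffun {set G} -> rat^o}.

Section Exterior.

Variable G : finType.
Implicit Types (a b c : G) (S T U : {set G}) (x y z : exterior G).

Definition ext_mon S : exterior G := [ffun T => (T == S)%:R].

Definition ext_gen a : exterior G := ext_mon [set a].

(* For disjoint S and T, e_S * e_T = ext_sign S T *: e_(S :|: T): one sign change
   per pair (a, b) in S x T that is out of order. *)
Definition ext_swap a b : rat := (-1) ^+ (enum_rank b < enum_rank a)%N.

Definition ext_sign S T : rat := \prod_(a in S) \prod_(b in T) ext_swap a b.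

Definition ext_mon_mul S T : exterior G :=
  if [disjoint S & T] then ext_sign S T *: ext_mon (S :|: T) else 0.

Definition ext_mul x y : exterior G :=
  \sum_S \sum_T (x S * y T : rat) *: ext_mon_mul S T.

Lemma ext_expand x : x = \sum_S (x S : rat) *: ext_mon S.
Proof.
apply/ffunP=> T; rewrite sum_ffunE (bigD1 T) //= big1 ?addr0 => [|S neS].
  by rewrite !ffunE eqxx [RHS]mulr1.
by rewrite !ffunE eq_sym (negPf neS) [LHS]mulr0.
Qed.

Lemma ext_monE S T : ext_mon S T = (T == S)%:R.
Proof. by rewrite ffunE. Qed.

Fact ext_mulDl : left_distributive ext_mul +%R.
Proof.
move=> x y z; rewrite /ext_mul -big_split; apply: eq_bigr => S _ /=.
by rewrite -big_split; apply: eq_bigr => T _; rewrite /= ffunE mulrDl scalerDl.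
Qed.

Fact ext_mulDr : right_distributive ext_mul +%R.
Proof.
move=> x y z; rewrite /ext_mul -big_split; apply: eq_bigr => S _ /=.
by rewrite -big_split; apply: eq_bigr => T _; rewrite /= ffunE mulrDr scalerDl.
Qed.

Fact ext_mulZl (k : rat) x y : k *: ext_mul x y = ext_mul (k *: x) y.
Proof.
rewrite /ext_mul scaler_sumr; apply: eq_bigr => S _.
rewrite scaler_sumr; apply: eq_bigr => T _.
by rewrite scalerA mulrA ffunE.
Qed.

Fact ext_mulZr (k : rat) x y : k *: ext_mul x y = ext_mul x (k *: y).
Proof.
rewrite /ext_mul scaler_sumr; apply: eq_bigr => S _.
rewrite scaler_sumr; apply: eq_bigr => T _.
by rewrite scalerA mulrCA ffunE.
Qed.

Fact ext_mul_monE S T : ext_mul (ext_mon S) (ext_mon T) = ext_mon_mul S T.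
Proof.
rewrite /ext_mul (bigD1 S) //= (bigD1 T) //= !ext_monE !eqxx mulr1 scale1r.
rewrite big1 ?addr0 => [|T' neT]; last first.
  by rewrite ext_monE (negPf neT) mulr0 scale0r.
rewrite big1 ?addr0 // => S' neS; rewrite big1 // => T' _.
by rewrite ext_monE (negPf neS) mul0r scale0r.
Qed.

Fact ext_mul0l y : ext_mul 0 y = 0.
Proof. by have := ext_mulZl 0 0 y; rewrite !scale0r. Qed.

Fact ext_mul0r x : ext_mul x 0 = 0.
Proof. by have := ext_mulZr 0 x 0; rewrite !scale0r. Qed.

Fact ext_mul_suml (I : finType) (F : I -> exterior G) y :
  ext_mul (\sum_i F i) y = \sum_i ext_mul (F i) y.
Proof.
exact: (big_morph (fun x => ext_mul x y) (fun x x' => ext_mulDl x x' y)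
          (ext_mul0l y)).
Qed.

Fact ext_mul_sumr (I : finType) (F : I -> exterior G) x :
  ext_mul x (\sum_i F i) = \sum_i ext_mul x (F i).
Proof. exact: (big_morph (ext_mul x) (ext_mulDr x) (ext_mul0r x)). Qed.

Lemma ext_signUl S T U : [disjoint S & T] ->
  ext_sign (S :|: T) U = ext_sign S U * ext_sign T U.
Proof.
by move=> dST; rewrite /ext_sign -bigU //=; apply: eq_bigl => a; rewrite inE.
Qed.

Lemma ext_signUr S T U : [disjoint T & U] ->
  ext_sign S (T :|: U) = ext_sign S T * ext_sign S U.
Proof.
move=> dTU; rewrite /ext_sign -big_split; apply: eq_bigr => a _ /=.
by rewrite -bigU //=; apply: eq_bigl => b; rewrite inE.
Qed.


Fact ext_mon_mulA S T U :
  ext_mul (ext_mon S) (ext_mon_mul T U) = ext_mul (ext_mon_mul S T) (ext_mon U).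
Proof.
have dUl (A B C : {set G}) :
    [disjoint A :|: B & C] = [disjoint A & C] && [disjoint B & C].
  by rewrite -!setI_eq0 setIUl setU_eq0.
have dUr (A B C : {set G}) :
    [disjoint C & A :|: B] = [disjoint C & A] && [disjoint C & B].
  by rewrite -!setI_eq0 setIUr setU_eq0.
rewrite /ext_mon_mul; case dTU: [disjoint T & U]; case dST: [disjoint S & T].
- rewrite -ext_mulZl -ext_mulZr !ext_mul_monE /ext_mon_mul dUl dUr dST dTU andbT /=.
  case: ifP => _ /=; last by rewrite !scaler0.
  rewrite !scalerA ext_signUr // ext_signUl // setUA.
  by congr (_ *: _); ring.
- by rewrite ext_mul0l -ext_mulZr ext_mul_monE /ext_mon_mul dUr dST /= scaler0.
- by rewrite ext_mul0r -ext_mulZl ext_mul_monE /ext_mon_mul dUl dTU andbF scaler0.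
- by rewrite ext_mul0r ext_mul0l.
Qed.

Fact ext_mulA : associative ext_mul.
Proof.
move=> x y z; rewrite (ext_expand x) [LHS]ext_mul_suml.
rewrite [ext_mul (\sum_i _) y]ext_mul_suml [RHS]ext_mul_suml.
apply: eq_bigr => S _.
rewrite -[LHS]ext_mulZl -(ext_mulZl _ _ y) -[RHS]ext_mulZl; congr (_ *: _).
rewrite (ext_expand y) [ext_mul (\sum_i _) z]ext_mul_suml.
rewrite [ext_mul (ext_mon S) (\sum_i _ *: ext_mon _)]ext_mul_sumr.
rewrite [LHS]ext_mul_sumr [RHS]ext_mul_suml.
apply: eq_bigr => T _.
rewrite -(ext_mulZl _ _ z) -[LHS]ext_mulZr.
rewrite -[ext_mul _ (_ *: ext_mon T)]ext_mulZr -[RHS]ext_mulZl; congr (_ *: _).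
rewrite (ext_expand z) [ext_mul (ext_mon T) _]ext_mul_sumr.
rewrite [LHS]ext_mul_sumr [RHS]ext_mul_sumr; apply: eq_bigr => U _.
by rewrite -!ext_mulZr !ext_mul_monE ext_mon_mulA.
Qed.

Fact ext_mul1l : left_id (ext_mon set0) ext_mul.
Proof.
move=> x; rewrite [in RHS](ext_expand x) {1}(ext_expand x) ext_mul_sumr.
apply: eq_bigr => S _; rewrite -ext_mulZr ext_mul_monE /ext_mon_mul.
by rewrite -setI_eq0 set0I eqxx set0U /ext_sign big_set0 scale1r.
Qed.

Fact ext_mul1r : right_id (ext_mon set0) ext_mul.
Proof.
move=> x; rewrite [in RHS](ext_expand x) {1}(ext_expand x) ext_mul_suml.
apply: eq_bigr => S _; rewrite -ext_mulZl ext_mul_monE /ext_mon_mul.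
rewrite -setI_eq0 setI0 eqxx setU0 /ext_sign big1 ?scale1r // => a _.
by rewrite big_set0.
Qed.

Fact ext_oner_neq0 : ext_mon set0 != 0.
Proof. by apply/eqP=> /ffunP/(_ set0)/eqP; rewrite !ffunE eqxx oner_eq0. Qed.

HB.instance Definition _ := GRing.Zmodule_isNzRing.Build (exterior G)
  ext_mulA ext_mul1l ext_mul1r ext_mulDl ext_mulDr ext_oner_neq0.
HB.instance Definition _ :=
  GRing.Lmodule_isLalgebra.Build rat (exterior G) ext_mulZl.
HB.instance Definition _ :=
  GRing.Lalgebra_isAlgebra.Build rat (exterior G) ext_mulZr.
HB.instance Definition _ := Algebra_isFalgebra.Build rat (exterior G).

Lemma ext_monM S T : ext_mon S * ext_mon T = ext_mon_mul S T.
Proof. exact: ext_mul_monE. Qed.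

Lemma ext_swapC a b : a != b -> ext_swap a b = - ext_swap b a.
Proof.
rewrite -(inj_eq enum_rank_inj) -(inj_eq val_inj) /= /ext_swap.
by case: ltngtP => // _ _; rewrite /= ?expr0 ?expr1 ?opprK.
Qed.

Lemma ext_genM a b : ext_gen a * ext_gen b = - (ext_gen b * ext_gen a).
Proof.
rewrite !ext_monM /ext_mon_mul disjoint_sym.
case: ifP; last by rewrite oppr0.
rewrite disjoints1 inE setUC /ext_sign !big_set1 -scaleNr => neq.
by rewrite ext_swapC // eq_sym neq.
Qed.

Lemma ext_gen_sqr a : ext_gen a * ext_gen a = 0.
Proof.
rewrite ext_monM /ext_mon_mul -setI_eq0 setIid; case: eqP => // /setP/(_ a).
by rewrite !inE eqxx.
Qed.

Lemma ext_swap_sqr a b : ext_swap a b * ext_swap a b = 1.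
Proof. by rewrite /ext_swap -expr2 sqrr_sign. Qed.

Lemma prod_ext_gen s : uniq s ->
  \prod_(a <- s) ext_gen a = pair_prod ext_swap s *: ext_mon [set:: s].
Proof.
elim: s => [|a s IH] /=; first by rewrite big_nil scale1r set_nil.
case/andP=> sNa us; rewrite big_cons IH // -scalerAr ext_monM /ext_mon_mul.
rewrite disjoints1 inE sNa set_cons scalerA mulrC; congr (_ * _ *: _).
rewrite /ext_sign big_set1 ?big_uniq //=; apply: eq_bigl => b.
by rewrite inE.
Qed.

Lemma prod_ext_gen0 s : ~~ uniq s -> \prod_(a <- s) ext_gen a = 0.
Proof.
elim: s => //= a s IH; rewrite negb_and negbK big_cons.
have [us /=|nus _] := boolP (uniq s); last by rewrite IH // mulr0.
rewrite orbF => sa; rewrite prod_ext_gen // -scalerAr ext_monM /ext_mon_mul.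
by rewrite disjoints1 inE sa scaler0.
Qed.

Lemma pair_prod_enum S : pair_prod ext_swap (enum S) = 1.
Proof.
have : pairwise (fun a b => enum_rank a < enum_rank b)%N (enum S).
  apply: (@subseq_pairwise _ _ _ (enum G)).
    by rewrite {1}/enum_mem; apply: subseq_trans (filter_subseq _ _) _;
       rewrite enumT.
  rewrite -(pairwise_map (fun a => val (enum_rank a)) ltn).
  have -> : [seq val (enum_rank a) | a <- enum G] = iota 0 #|G|.
    apply: (@eq_from_nth _ 0%N); first by rewrite size_map size_iota -cardE.
    move=> i; rewrite size_map -cardE => lti.
    have a0 := enum_val (Ordinal lti).
    rewrite (nth_map a0) -?cardE // nth_iota // add0n.
    by rewrite -(enum_val_nth a0 (Ordinal lti)) enum_valK.
  by rewrite -sorted_pairwise ?iota_ltn_sorted //; apply: ltn_trans.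
elim: (enum S) => //= a s IH /andP[/allP ltas /IH->]; rewrite mulr1.
rewrite big_seq big1 // => b sb; rewrite /ext_swap.
by rewrite ltnNge ltnW ?ltas.
Qed.

(* The linear map that sends each wedge of distinct generators a_1, ..., a_m,
   in the order of enum G, to f a_1 * ... * f a_m. *)
Definition ext_lift (A : falgType rat) (f : G -> A) x : A :=
  \sum_S (x S : rat) *: \prod_(a <- enum S) f a.

Lemma ext_lift_is_linear (A : falgType rat) (f : G -> A) : linear (ext_lift f).
Proof.
move=> k x y; rewrite /ext_lift scaler_sumr -big_split; apply: eq_bigr => S _.
by rewrite /= !ffunE scalerDl scalerA.
Qed.

HB.instance Definition _ (A : falgType rat) (f : G -> A) :=
  GRing.isLinear.Build rat (exterior G) A *:%R (ext_lift f)
    (ext_lift_is_linear f).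

Lemma ext_lift_mon (A : falgType rat) (f : G -> A) S :
  ext_lift f (ext_mon S) = \prod_(a <- enum S) f a.
Proof.
rewrite /ext_lift (bigD1 S) //= ext_monE eqxx scale1r [X in _ + X]big1 ?addr0 // => T neT.
by rewrite ext_monE (negPf neT) scale0r.
Qed.

Lemma ext_lift_gen (A : falgType rat) (f : G -> A) a :
  ext_lift f (ext_gen a) = f a.
Proof. by rewrite ext_lift_mon enum_set1 big_seq1. Qed.

Lemma prod_enum_ext_gen S : \prod_(a <- enum S) ext_gen a = ext_mon S.
Proof.
rewrite prod_ext_gen ?enum_uniq // pair_prod_enum scale1r.
by congr ext_mon; apply/setP=> a; rewrite inE mem_enum.
Qed.

Section Substitution.

Variable g : G -> G.
Hypothesis g_inj : injective g.

Local Notation gact := (ext_lift (fun a => ext_gen (g a))).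

Lemma ext_lift_prod_gen s :
  gact (\prod_(a <- s) ext_gen a) = \prod_(a <- s) ext_gen (g a).
Proof.
rewrite -(big_map g predT ext_gen); have [us|nus] := boolP (uniq s); last first.
  by rewrite !prod_ext_gen0 ?linear0 // (map_inj_uniq g_inj).
have pe : perm_eq s (enum [set:: s]).
  by apply: uniq_perm; rewrite ?enum_uniq // => a; rewrite mem_enum inE.
rewrite prod_ext_gen // linearZ /= ext_lift_mon.
rewrite -(big_map g predT ext_gen) !prod_ext_gen ?(map_inj_uniq g_inj) ?enum_uniq //.
have -> : [set:: map g (enum [set:: s])] = [set:: map g s].
  by apply/setP=> a; rewrite !inE; apply/esym/perm_mem/perm_map.
rewrite scalerA; congr (_ *: _).
pose h a b := ext_swap a b * ext_swap (g a) (g b).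
have hC a b : h a b = h b a.
  have [->//|neab] := eqVneq a b.
  by rewrite /h ext_swapC // [ext_swap (g a) _]ext_swapC ?(inj_eq g_inj) // mulrNN.
have := pair_prod_perm hC pe; rewrite !pair_prodM pair_prod_enum mul1r.
rewrite !pair_prod_map => <-; rewrite mulrA -pair_prodM.
suff -> : pair_prod (fun a b => ext_swap a b * ext_swap a b) s = 1 by rewrite mul1r.
by elim: (s) => //= a s' ->; rewrite mulr1 big1 // => b _; apply: ext_swap_sqr.
Qed.

Lemma ext_lift_gen_monoid : monoid_morphism gact.
Proof.
split=> [|x y]; first by rewrite [LHS]ext_lift_mon enum_set0 big_nil.
rewrite (ext_expand x) (ext_expand y) mulr_suml !linear_sum mulr_suml.
apply: eq_bigr => S _; rewrite mulr_sumr !linear_sum mulr_sumr.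
apply: eq_bigr => T _; rewrite -!scalerAl !linearZ -!scalerAr linearZ /=.
rewrite -scalerAl !scalerA mulrC; congr (_ *: _).
rewrite -(prod_enum_ext_gen S) -(prod_enum_ext_gen T) -big_cat.
by rewrite !ext_lift_prod_gen big_cat.
Qed.

End Substitution.

Definition ext_deg (k : nat) : {vspace exterior G} :=
  <<[seq ext_mon B | B : {set G} in [pred B : {set G} | #|B| == k]]>>%VS.

Lemma ext_deg_big k : (#|G| < k)%N -> ext_deg k = 0%VS.
Proof.
move=> ltGk; apply/eqP; rewrite -subv0; apply/span_subvP => x /mapP[S].
by rewrite mem_enum inE => /eqP cS; move: ltGk; rewrite -cS ltnNge max_card.
Qed.

End Exterior.

Section QuotientSpace.

Variables (K : fieldType) (V : vectType K) (U : {vspace V}).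

(* The quotient V / U, carried by the complement U^C; by quotv_pi_eq0 and
   quotv_pi_surj, quotv_pi is onto with kernel U. *)
Definition quotv : vectType K := subvs_of U^C.

Definition quotv_pi : 'Hom(V, quotv) :=
  (linfun (vsproj U^C) \o daddv_pi U^C U)%VF.

(* The endomorphism of V / U induced by f when f @: U <= U (quotv_mapE). *)
Definition quotv_map (f : 'End(V)) : 'End(quotv) :=
  (quotv_pi \o f \o linfun vsval)%VF.

Let capUC : (U^C :&: U = 0)%VS.
Proof. by rewrite capvC capv_compl. Qed.

Lemma val_quotv_pi v : vsval (quotv_pi v) = daddv_pi U^C U v.
Proof. by rewrite comp_lfunE lfunE /= vsprojK ?memv_pi. Qed.

Lemma sub_quotv_pi v : v - vsval (quotv_pi v) \in U.
Proof.
have vU : v \in (U^C + U)%VS by rewrite addvC addv_complf memvf.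
by rewrite val_quotv_pi -{1}(daddv_pi_add capUC vU) addrAC subrr add0r memv_pi.
Qed.

Lemma quotv_valK q : quotv_pi (vsval q) = q.
Proof. by apply: val_inj; rewrite /= val_quotv_pi daddv_pi_id ?subvsP. Qed.

Lemma quotv_pi_surj q : exists v, quotv_pi v = q.
Proof. by exists (vsval q); apply: quotv_valK. Qed.

Lemma quotv_pi_eq0 v : (quotv_pi v == 0) = (v \in U).
Proof.
apply/eqP/idP => [v0|vU]; first by have := sub_quotv_pi v; rewrite v0 [vsval _]linear0 subr0.
apply/val_inj/eqP; rewrite -memv0 -capUC memv_cap subvsP /=.
by rewrite -[vsval _](subKr v) rpredB ?sub_quotv_pi.
Qed.

Lemma quotv_mapE f v :
  (f @: U <= U)%VS -> quotv_map f (quotv_pi v) = quotv_pi (f v).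
Proof.
move=> fU; have ->: quotv_map f (quotv_pi v) = quotv_pi (f (vsval (quotv_pi v))).
  by rewrite /quotv_map [LHS]comp_lfunE [in LHS]lfunE /=; congr (quotv_pi (f _)); rewrite lfunE.
apply/eqP; rewrite -subr_eq0 -linearB quotv_pi_eq0 /=.
rewrite -linearB (subvP fU) //.
by rewrite memv_img // -opprB rpredN sub_quotv_pi.
Qed.

End QuotientSpace.

(* The trace of the endomorphism that f induces on a subspace U it stabilizes. *)
Definition trace_on (K : fieldType) (V : vectType K) (U : {vspace V})
    (f : 'End(V)) : K :=
  \sum_(i < \dim U) coord (vbasis U) i (f (vbasis U)`_i).

Definition pvb_index (n : nat) : finType := {p : 'I_n * 'I_n | p.1 != p.2}.

Section PureVirtualBraid.

Variable n : nat.
Implicit Types (i j k : 'I_n) (s : 'S_n).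

Local Notation E := (exterior (pvb_index n)).

(* r_ij, with the convention r_ii = 0. *)
Definition pvb_r i j : E :=
  if insub (i, j) is Some p then ext_gen (p : pvb_index n) else 0.

Definition pvb_rel1 i j k : E :=
  pvb_r i j * pvb_r i k - (pvb_r i j * pvb_r j k - pvb_r i k * pvb_r k j).

Definition pvb_rel2 i j k : E :=
  pvb_r i k * pvb_r j k - (pvb_r i j * pvb_r j k - pvb_r j i * pvb_r i k).

Definition pvb_rel3 i j : E := pvb_r i j * pvb_r j i.

(* r_ij * r_ji is imposed for all i != j, hence also when n = 2. *)
Definition pvb_relations : {vspace E} :=
  (\sum_i \sum_(j | j != i)
     (<[pvb_rel3 i j]> +
      \sum_(k | uniq [:: i; j; k]) (<[pvb_rel1 i j k]> + <[pvb_rel2 i j k]>)))%VS.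

Definition pvb_ideal : {vspace E} := ({:E} * pvb_relations * {:E})%VS.

Definition pvb : vectType rat := quotv pvb_ideal.

Definition pvb_deg (k : nat) : {vspace pvb} :=
  (quotv_pi pvb_ideal @: ext_deg (pvb_index n) k)%VS.

(* The algebra endomorphism of E with r_ij |-> r_(s i)(s j). *)
Definition pvb_ext_act s : 'End(E) :=
  linfun (ext_lift (fun p : pvb_index n => pvb_r (s (val p).1) (s (val p).2))).

Definition pvb_act s : 'End(pvb) := quotv_map pvb_ideal (pvb_ext_act s).

Lemma pvb_rE (p : pvb_index n) : pvb_r (val p).1 (val p).2 = ext_gen p.
Proof. by rewrite /pvb_r -surjective_pairing valK. Qed.

Lemma pvb_ext_act_r s i j :
  pvb_ext_act s (pvb_r i j) = pvb_r (s i) (s j).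
Proof.
rewrite lfunE /=; have [<-|neij] := eqVneq i j.
  by rewrite /pvb_r !insubN /= ?eqxx ?linear0.
pose p : pvb_index n := exist (fun q : 'I_n * 'I_n => is_true (q.1 != q.2)) (i, j) neij.
by rewrite (pvb_rE p) ext_lift_gen.
Qed.

Fact pvb_index_act_subproof s (p : pvb_index n) :
  s (val p).1 != s (val p).2.
Proof. by rewrite (inj_eq perm_inj) (valP p). Qed.

Definition pvb_index_act s p : pvb_index n :=
  exist (fun q : 'I_n * 'I_n => is_true (q.1 != q.2))
    (s (val p).1, s (val p).2) (pvb_index_act_subproof s p).

Lemma pvb_index_act_inj s : injective (pvb_index_act s).
Proof.
move=> [[i j] ij] [[i' j'] ij'] /(congr1 val)[/perm_inj eqi /perm_inj eqj].
by apply: val_inj; rewrite /= eqi eqj.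
Qed.

Lemma pvb_ext_actE s x :
  pvb_ext_act s x =
  ext_lift (fun p => ext_gen (pvb_index_act s p)) x.
Proof.
rewrite lfunE /=; apply: eq_bigr => S _; congr (_ *: _).
by apply: eq_bigr => p _; rewrite -pvb_rE.
Qed.

Lemma pvb_ext_act_monoid s : monoid_morphism (pvb_ext_act s).
Proof.
have [act1 actM] := ext_lift_gen_monoid (@pvb_index_act_inj s).
by split=> [|x y]; rewrite !pvb_ext_actE.
Qed.

Lemma pvb_ext_act_ideal s : (pvb_ext_act s @: pvb_ideal <= pvb_ideal)%VS.
Proof.
have aM : ahom_in fullv (pvb_ext_act s).
  by apply/ahomP_tmp; apply: pvb_ext_act_monoid.
have -> : pvb_ext_act s = AHom aM by [].
rewrite /pvb_ideal !aimgM /=.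
apply: prodvS (subvf _); apply: prodvS (subvf _) _.
rewrite /pvb_relations limg_sum; apply/subv_sumP => i _.
rewrite limg_sum; apply/subv_sumP => j neji.
have mem U : (U <= <[pvb_rel3 (s i) (s j)]> +
      \sum_(k | uniq [:: s i; s j; k])
         (<[pvb_rel1 (s i) (s j) k]> + <[pvb_rel2 (s i) (s j) k]>))%VS ->
    (U <= pvb_relations)%VS.
  move=> sU; apply: subv_trans sU _; apply: (sumv_sup (s i)) => //.
  by apply: (sumv_sup (s j)) => //; rewrite (inj_eq perm_inj).
apply: mem; have [_ actM] := pvb_ext_act_monoid s.
rewrite limgD limg_line {1}/pvb_rel3 actM !pvb_ext_act_r addvS //.
rewrite limg_sum; apply/subv_sumP => k uk; apply: (sumv_sup (s k)).
  by rewrite -(map_inj_uniq (@perm_inj _ s)) in uk.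
rewrite limgD !limg_line {1}/pvb_rel1 {1}/pvb_rel2.
by rewrite !linearB /= !actM !pvb_ext_act_r /pvb_rel1 /pvb_rel2 !opprD subvv.
Qed.

Lemma pvb_actE s x :
  pvb_act s (quotv_pi pvb_ideal x) = quotv_pi pvb_ideal (pvb_ext_act s x).
Proof. exact/quotv_mapE/pvb_ext_act_ideal. Qed.

Lemma pvb_act_deg s k : (pvb_act s @: pvb_deg k <= pvb_deg k)%VS.
Proof.
have -> : (pvb_act s @: pvb_deg k =
           quotv_pi pvb_ideal @: (pvb_ext_act s @: ext_deg (pvb_index n) k))%VS.
  rewrite /pvb_deg -!limg_comp; congr (lfun_img _ _); apply/lfunP=> x.
  by rewrite [LHS]comp_lfunE [RHS]comp_lfunE; apply: pvb_actE.
apply: limgS; rewrite limg_span; apply/span_subvP => x /mapP[y + ->].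
case/mapP=> S; rewrite mem_enum unfold_in => /eqP cS ->.
rewrite pvb_ext_actE ext_lift_mon -(big_map (pvb_index_act s) predT (@ext_gen _)).
rewrite prod_ext_gen ?(map_inj_uniq (@pvb_index_act_inj s)) ?enum_uniq //.
apply/rpredZ/memv_span/map_f.
rewrite mem_enum inE cardsE (card_uniqP _) ?size_map -?cardE ?cS //.
by rewrite (map_inj_uniq (@pvb_index_act_inj s)) enum_uniq.
Qed.

(* Degrees beyond #|pvb_index n| vanish (pvb_deg_big), so the polynomials below
   are the full generating series over all k >= 0. *)
Lemma pvb_deg_big k : (#|pvb_index n| < k)%N -> pvb_deg k = 0%VS.
Proof. by move=> ltk; rewrite /pvb_deg ext_deg_big // limg0. Qed.

Definition pvb_hilbert : {poly rat} :=
  \poly_(k < #|pvb_index n|.+1) (\dim (pvb_deg k))%:R.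

Definition pvb_char s : {poly rat} :=
  \poly_(k < #|pvb_index n|.+1) trace_on (pvb_deg k) (pvb_act s).

End PureVirtualBraid.

(* The lengths of the cycles of s, fixed points included. *)
Definition cycle_lengths (n : nat) (s : 'S_n) : seq nat :=
  [seq #|pred_of_set C| | C <- enum (porbits s)].

(* p is a partition of n, listed in any order. *)
Definition has_cycle_type (n : nat) (s : 'S_n) (p : seq nat) : bool :=
  perm_eq (cycle_lengths s) p.

Definition homogeneous (p : seq nat) : Prop :=
  exists k a : nat, [/\ (0 < k)%N, (0 < a)%N & perm_eq p (nseq a k)].

(* The partition of \sum_(1 <= i <= r) i * alpha i having, for each i in
   1, ..., r, exactly alpha i parts equal to i. *)
Definition partition_of_mults (r : nat) (alpha : nat -> nat) : seq nat :=
  flatten [seq nseq (alpha i) i | i <- iota 1 r].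

(* Ordered subsets are encoded as tuples; lah_partition requires them to be
   nonempty and duplicate-free, with each element of 'I_m in exactly one. *)
Definition ordered_subset (m : nat) : finType :=
  {l : 'I_m.+1 & l.-tuple 'I_m}.

Definition lah_partition (m q : nat) (X : {set ordered_subset m}) : bool :=
  [&& #|X| == q,
      [forall b in X, (0 < size (tagged b))%N && uniq (tagged b)] &
      [forall x : 'I_m, #|[set b in X | x \in tagged b]| == 1%N]].

Definition lah (m q : nat) : nat := #|[set X : {set ordered_subset m} | lah_partition q X]|.

(* Every homogeneous cycle type is realized. *)
Lemma has_cycle_type_nseq (k a : nat) :
  (0 < k)%N -> exists s : 'S_(k * a), has_cycle_type s (nseq a k).
Proof.
move=> k0; pose f m := (m %/ k * k + m.+1 %% k)%N.
have fdiv m : (f m %/ k = m %/ k)%N by rewrite /f divnMDl // (divn_small (ltn_pmod _ k0)) addn0.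
have fmod m : (f m = m.+1 %[mod k])%N by rewrite /f modnMDl modn_mod.
have iterE j m : iter j f m = (m %/ k * k + (m + j) %% k)%N.
  elim: j => [|j IH]; first by rewrite addn0 -divn_eq.
  rewrite iterS IH {1}/f divnMDl // (divn_small (ltn_pmod _ k0)) addn0.
  by congr (_ + _)%N; rewrite -addnS modnMDl -addn1 modnDml addn1 addnS.
have ltE m : (m < k * a)%N = (m %/ k < a)%N by rewrite ltn_divLR // mulnC.
have flt (x : 'I_(k * a)) : (f x < k * a)%N.
  by rewrite ltE fdiv -ltE.
have finj : injective (fun x : 'I_(k * a) => Ordinal (flt x)).
  move=> x y /(congr1 val) /= fxy; apply: val_inj => /=.
  have dxy : (x %/ k = y %/ k)%N by rewrite -fdiv fxy fdiv.
  have mxy : (x = y %[mod k])%N.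
    by apply/eqP; rewrite -(eqn_modDr 1) !addn1 -!fmod fxy.
  by rewrite (divn_eq x k) (divn_eq y k) dxy mxy.
pose s := perm finj; exists s.
have sX j x : val ((s ^+ j)%g x) = iter j f x.
  by elim: j => [|j IH]; rewrite ?expg0 ?perm1 // expgSr permM permE /= IH.
have porbE x : porbit s x = [set y : 'I_(k * a) | y %/ k == x %/ k]%N.
  apply/setP=> y; rewrite inE; apply/porbitP/eqP => [[j ->]|dyx].
    by rewrite sX iterE divnMDl // (divn_small (ltn_pmod _ k0)) addn0.
  exists (k - x %% k + y)%N; apply: val_inj; rewrite sX iterE -dyx.
  rewrite [LHS](divn_eq y k); congr (_ + _)%N; rewrite addnA -modnDml.
  rewrite -(modnDml x) subnKC; last by rewrite ltnW ?ltn_mod.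
  by rewrite modnn add0n.
have cardC x : #|porbit s x| = k.
  have glt (i : 'I_k) : (x %/ k * k + i < k * a)%N.
    by rewrite ltE divnMDl // (divn_small (ltn_ord i)) addn0 -ltE.
  have ginj : injective (fun i : 'I_k => Ordinal (glt i)).
    by move=> i j /(congr1 val) /= /addnI /val_inj.
  rewrite porbE -[RHS]card_ord -(card_imset _ ginj); apply: eq_card => y.
  rewrite inE; apply/eqP/imsetP => [dyx|[i _ ->]] /=.
    have lty : (y %% k < k)%N by rewrite ltn_mod.
    by exists (Ordinal lty) => //; apply: val_inj; rewrite /= -dyx -divn_eq.
  by rewrite divnMDl // (divn_small (ltn_ord i)) addn0.
have /all_pred1P cl : all (pred1 k) (cycle_lengths s).
  apply/allP=> m /mapP[C]; rewrite mem_enum => /imsetP[x _ ->] ->.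
  by rewrite /= cardC.
rewrite /has_cycle_type cl size_map -cardE.
suff -> : #|porbits s| = a by [].
apply/eqP; rewrite -(eqn_pmul2r k0) [X in _ == X]mulnC -[X in _ == X]card_ord.
rewrite -[X in _ == X]sum1_card (partition_big (porbit s) [in porbits s]) /=; last first.
  by move=> x _; apply: imset_f.
rewrite -sum_nat_const; apply/eqP; apply: eq_bigr => C /imsetP[z _ ->].
rewrite sum1_card; apply: etrans (esym (cardC z)) _; apply: eq_card => x.
by rewrite [RHS]eq_porbit_mem.
Qed.

(* Main.v *)
(* Modulo the relations, every monomial is a combination of chain forests: sets
   of arcs in which each vertex has at most one outgoing and one incoming arc,
   and no cycle. Chain forests are also independent. Indeed a chain forest F
   orders each of its chains; with v_i the sum of the generators y_l, l <=_F i,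
   the map r_ij |-> v_j - v_i if i <_F j, and 0 otherwise, is an algebra morphism
   from pvb to an exterior algebra, and F is the only chain forest with #|F| arcs
   that it does not kill.
   A permutation s permutes this basis up to sign, so its trace is a signed sum
   over the s-invariant chain forests. An arc of such a forest joins two points
   on cycles of s of the same length, whence the product formula. If all cycles
   have length k, an invariant chain forest is the lift of a chain forest on the
   set of cycles, each arc having k lifts, and each s-orbit of k arcs contributes
   the sign (-1)^(k-1). Finally the chain forests on m points with m - b arcs are
   the partitions of the points into b nonempty lists. *)
Require Import Defs.
From HB Require Import structures.
From mathcomp Require Import all_boot all_order all_algebra all_fingroup all_field.
From mathcomp Require Import ring.

Set Implicit Arguments.
Unset Strict Implicit.
Unset Printing Implicit Defensive.

Import GRing.Theory.

Local Open Scope ring_scope.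

(** * Morphisms out of the exterior algebra *)

(** The obstacle in the spanning part is termination. When two arcs share a source or a target, a
    relation replaces one of them by an arc between their two unshared ends, and this arc may
    collide with further ones. Old connections survive every replacement, so either a new pair
    becomes connected or, if none does, the new arc spans a strictly smaller interval than the one
    it replaces; hence a lexicographic measure. For independence, the differences d_ij = v_j - v_i
    anticommute, square to zero and satisfy d_ij + d_jk = d_ik. These identities give the relations,
    because two elements of a chain forest that lie above, or below, a common element are
    comparable. Signs are not computed in general. Spanning needs only nonzero scalars; on invariant
    forests the sign is multiplicative over disjoint orbits of arcs, and on a single orbit it is the
    sign of a rotation of anticommuting factors. *)

Section AnticommutingLift.

Variables (G : finType) (A : falgType rat) (f : G -> A).
Hypothesis f_sqr : forall a, f a * f a = 0.
Hypothesis f_anti : forall a b, f a * f b = - (f b * f a).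
Implicit Types (a b : G) (s t : seq G).

Lemma prod_anticomm_front s1 a s2 :
  \prod_(b <- s1 ++ a :: s2) f b =
  (-1) ^+ size s1 * (f a * \prod_(b <- s1 ++ s2) f b).
Proof.
elim: s1 => [|c s1 IH] /=; first by rewrite big_cons mul1r.
have fC x : f c * (f a * x) = - (f a * (f c * x)).
  by rewrite mulrA f_anti mulNr mulrA.
rewrite !big_cons IH exprS mulN1r mulNr -signr_odd !mulr_sign.
by case: odd; rewrite ?mulrN fC ?opprK.
Qed.

Lemma prod_anticomm_uniq0 s : ~~ uniq s -> \prod_(b <- s) f b = 0.
Proof.
elim: s => //= a s IH; rewrite negb_and negbK big_cons.
have [us /=|nus _] := boolP (uniq s); last by rewrite IH // mulr0.
rewrite orbF => /splitPr[s1 s2]; rewrite prod_anticomm_front.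
by rewrite -signr_odd mulr_sign; case: odd; rewrite ?mulrN mulrA f_sqr mul0r ?oppr0.
Qed.

Lemma pair_prod_swap_front s1 a s2 : a \notin s1 ->
  pair_prod (@ext_swap G) (s1 ++ a :: s2) =
  (-1) ^+ size s1 * pair_prod (@ext_swap G) (a :: s1 ++ s2).
Proof.
elim: s1 => [|c s1 IH]; first by rewrite mul1r.
rewrite inE negb_or => /andP[ac as1] /=; rewrite IH //= !big_cat !big_cons /=.
rewrite ext_swapC 1?eq_sym // exprS !big_cat /=; ring.
Qed.

(** Moving a factor to the front changes the product and the pair sign by the same power of -1, so
    the signed product does not depend on the order. *)
Lemma prod_anticomm_perm s t : uniq s -> perm_eq s t ->
  pair_prod (@ext_swap G) s *: \prod_(b <- s) f b =
  pair_prod (@ext_swap G) t *: \prod_(b <- t) f b.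
Proof.
elim: t s => [|a t IH] s us st.
  by move/perm_nilP: st => ->.
have sa : a \in s by rewrite (perm_mem st) mem_head.
case/splitPr: sa us st => s1 s2 us st.
have {}st : perm_eq (s1 ++ s2) t.
  by rewrite -(perm_cons a) (perm_trans _ st) // -(cat1s a) -[a :: s2]cat1s perm_catCA.
have /= /andP[as12 us12] : uniq (a :: s1 ++ s2).
  by rewrite -(cat1s a) uniq_catCA cat1s.
have as1 : a \notin s1 by move: as12; rewrite mem_cat; case/norP.
rewrite prod_anticomm_front pair_prod_swap_front //.
have -> (x : A) : (-1) ^+ size s1 * x = ((-1) ^+ size s1 : rat) *: x.
  by rewrite -[in RHS]signr_odd scaler_sign -signr_odd mulr_sign.
rewrite scalerA mulrAC -expr2 sqrr_sign mul1r /=.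
have -> : \prod_(b <- s1 ++ s2) ext_swap a b = \prod_(b <- t) ext_swap a b.
  exact: perm_big.
by rewrite big_cons -!scalerA; congr (_ *: _); rewrite !scalerAr IH.
Qed.

Lemma ext_lift_prod_anticomm s :
  ext_lift f (\prod_(a <- s) ext_gen a) = \prod_(a <- s) f a.
Proof.
have [us|nus] := boolP (uniq s); last first.
  by rewrite prod_ext_gen0 ?linear0 // prod_anticomm_uniq0.
have pe : perm_eq s (enum [set:: s]).
  by apply: uniq_perm; rewrite ?enum_uniq // => a; rewrite mem_enum inE.
rewrite prod_ext_gen // linearZ /= ext_lift_mon.
have /(congr1 (GRing.scale (pair_prod (@ext_swap G) s))) :=
  prod_anticomm_perm us pe.
rewrite pair_prod_enum scale1r => <-; rewrite scalerA.
suff -> : pair_prod (@ext_swap G) s * pair_prod (@ext_swap G) s = 1.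
  by rewrite scale1r.
rewrite -pair_prodM; elim: (s) => //= a s' ->.
by rewrite mulr1 big1 // => b _; apply: ext_swap_sqr.
Qed.

(** The universal property of the exterior algebra. Monomials suffice by bilinearity, and a
    generator common to both factors makes both sides vanish. *)
Lemma ext_lift_monoid : monoid_morphism (ext_lift f).
Proof.
split=> [|x y]; first by rewrite [LHS]ext_lift_mon enum_set0 big_nil.
rewrite (ext_expand x) (ext_expand y) mulr_suml !linear_sum mulr_suml.
apply: eq_bigr => S _; rewrite mulr_sumr !linear_sum mulr_sumr.
apply: eq_bigr => T _; rewrite -!scalerAl !linearZ -!scalerAr linearZ /=.
rewrite -scalerAl !scalerA mulrC; congr (_ *: _).
rewrite -(prod_enum_ext_gen S) -(prod_enum_ext_gen T) -big_cat.
by rewrite !ext_lift_prod_anticomm big_cat.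
Qed.

End AnticommutingLift.

(** * Rewriting monomials to chain forests *)

Section Forests.

Variable n : nat.
Implicit Types (i j k : 'I_n) (p q : pvb_index n) (S T X : {set pvb_index n}).

Lemma pvb_index_ex i j : i != j -> exists p : pvb_index n, val p = (i, j).
Proof.
by move=> neij; exists (exist (fun q : 'I_n * 'I_n => is_true (q.1 != q.2)) (i, j) neij).
Qed.

Definition arc S : rel 'I_n := fun i j => [exists p in S, val p == (i, j)].

Lemma arcP S i j : reflect (exists2 p, p \in S & val p = (i, j)) (arc S i j).
Proof. by apply: (iffP exists_inP) => -[p Sp /eqP]; exists p => //; apply/eqP. Qed.

Lemma arc_mem S p : p \in S -> arc S (val p).1 (val p).2.
Proof. by move=> Sp; apply/arcP; exists p; rewrite -?surjective_pairing. Qed.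

Lemma memP_arc S p i j : val p = (i, j) -> arc S i j = (p \in S).
Proof.
move=> pE; apply/arcP/idP => [[q Sq qE]|Sp]; last by exists p.
by have -> : p = q by apply: val_inj; rewrite pE qE.
Qed.

Lemma arc_neq S i j : arc S i j -> i != j.
Proof. by case/arcP=> p _ pE; have := valP p; rewrite pE. Qed.

Definition acyclic S := [forall p in S, ~~ connect (arc S) (val p).2 (val p).1].

Lemma acyclicP S :
  reflect (forall i j, arc S i j -> ~~ connect (arc S) j i) (acyclic S).
Proof.
apply: (iffP forall_inP) => [ac i j /arcP[p Sp pE]|ac p Sp]; last first.
  exact/ac/arc_mem.
by have := ac p Sp; rewrite pE.
Qed.

Lemma connect_cases (T : finType) (e : rel T) x y : connect e x y ->
  x = y \/ exists2 z, e x z & connect e z y.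
Proof.
case/connectP=> [[|z p] /= ep ->]; first by left.
by case/andP: ep => exz pz; right; exists z => //; apply/connectP; exists p.
Qed.

Lemma acyclic_anti S i j : acyclic S ->
  connect (arc S) i j -> connect (arc S) j i -> i = j.
Proof.
move=> /acyclicP ac /connect_cases[//|[k eik kj] ji].
by case/negP: (ac _ _ eik); apply: connect_trans kj ji.
Qed.

(** A rank is the certificate of acyclicity that passes easily to subsets, images, unions and lifts,
    where paths would be awkward to transport. *)
Lemma acyclic_rank S (rk : 'I_n -> nat) :
  (forall i j, arc S i j -> (rk i < rk j)%N) -> acyclic S.
Proof.
move=> rkS; have rk_connect i j : connect (arc S) i j -> (rk i <= rk j)%N.
  case/connectP=> p; elim: p i => [|k p IH] i /=; first by move=> _ ->.
  by case/andP=> /rkS/ltnW le_ik pk /(IH _ pk); apply: leq_trans.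
apply/acyclicP=> i j /rkS lt_ij; apply/negP => /rk_connect.
by rewrite leqNgt lt_ij.
Qed.

Definition out_inj S :=
  [forall p in S, forall q in S, ((val p).1 == (val q).1) ==> (p == q)].
Definition in_inj S :=
  [forall p in S, forall q in S, ((val p).2 == (val q).2) ==> (p == q)].

Definition chain_forest S := [&& out_inj S, in_inj S & acyclic S].

Lemma out_injP S :
  reflect {in S &, injective (fun p => (val p).1)} (out_inj S).
Proof.
apply: (iffP forall_inP) => [H p q Sp Sq pq|H p Sp].
  by have /forall_inP/(_ _ Sq) := H _ Sp; rewrite pq eqxx => /eqP.
by apply/forall_inP => q Sq; apply/implyP => /eqP /(H _ _ Sp Sq) ->.
Qed.

Lemma in_injP S :
  reflect {in S &, injective (fun p => (val p).2)} (in_inj S).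
Proof.
apply: (iffP forall_inP) => [H p q Sp Sq pq|H p Sp].
  by have /forall_inP/(_ _ Sq) := H _ Sp; rewrite pq eqxx => /eqP.
by apply/forall_inP => q Sq; apply/implyP => /eqP /(H _ _ Sp Sq) ->.
Qed.

Lemma out_inj_arc S i j k : out_inj S -> arc S i j -> arc S i k -> j = k.
Proof.
move=> /out_injP inj /arcP[p Sp pE] /arcP[q Sq qE].
by have [] : (i, j) = (i, k) by rewrite -pE -qE (inj p q) // pE qE.
Qed.

Lemma in_inj_arc S i j k : in_inj S -> arc S i k -> arc S j k -> i = j.
Proof.
move=> /in_injP inj /arcP[p Sp pE] /arcP[q Sq qE].
by have [] : (i, k) = (j, k) by rewrite -pE -qE (inj p q) // pE qE.
Qed.

Local Notation E := (exterior (pvb_index n)).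
Local Notation r := (@pvb_r n).
Implicit Types (x y : E).

Lemma pvb_ideal_mull x y : y \in pvb_ideal n -> x * y \in pvb_ideal n.
Proof.
move=> Iy; have : x * y \in (fullv * pvb_ideal n)%VS by rewrite memv_mul ?memvf.
by apply: subvP; rewrite /pvb_ideal !prodvA; do 2!apply: prodvSl; apply: subvf.
Qed.

Lemma pvb_ideal_mulr x y : x \in pvb_ideal n -> x * y \in pvb_ideal n.
Proof.
move=> Ix; have : x * y \in (pvb_ideal n * fullv)%VS by rewrite memv_mul ?memvf.
by apply: subvP; rewrite /pvb_ideal -!prodvA; do 2!apply: prodvSr; apply: subvf.
Qed.

Lemma pvb_relations_ideal x : x \in pvb_relations n -> x \in pvb_ideal n.
Proof.
by move=> Rx; rewrite -[x]mulr1 -[x]mul1r memv_mul ?memv_mul ?memvf.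
Qed.

Lemma pvb_rel3_ideal i j : j != i -> r i j * r j i \in pvb_ideal n.
Proof.
move=> neji; apply/pvb_relations_ideal; rewrite /pvb_relations memvE.
apply: (sumv_sup i) => //; apply: (sumv_sup j) => //.
exact: addvSl.
Qed.

Lemma pvb_rel12_ideal i j k : uniq [:: i; j; k] ->
  pvb_rel1 i j k \in pvb_ideal n /\ pvb_rel2 i j k \in pvb_ideal n.
Proof.
move=> u; have neji : j != i.
  by case/and3P: u; rewrite inE negb_or eq_sym => /andP[].
have mem x : x \in (<[pvb_rel1 i j k]> + <[pvb_rel2 i j k]>)%VS ->
    x \in pvb_ideal n.
  move=> xR; apply/pvb_relations_ideal; apply: subvP xR.
  apply: (sumv_sup i) => //; apply: (sumv_sup j) => //.
  by apply: subv_trans (addvSr _ _); apply: (sumv_sup k).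
split; apply: mem; first by apply: subvP (memv_line _); apply: addvSl.
by apply: subvP (memv_line _); apply: addvSr.
Qed.

Lemma pvb_rC i j k l : r i j * r k l = - (r k l * r i j).
Proof.
rewrite /pvb_r; case: insubP => [p _ _|_]; last by rewrite mul0r mulr0 oppr0.
case: insubP => [q _ _|_]; last by rewrite mul0r mulr0 oppr0.
exact: ext_genM.
Qed.

Lemma pvb_r_gen p i j : val p = (i, j) -> r i j = ext_gen p.
Proof. by move=> pE; rewrite -pvb_rE pE. Qed.

Fixpoint path_prod i (s : seq 'I_n) : E :=
  if s is j :: s' then r i j * path_prod j s' else 1.

(* With i -> j -> k the first two arcs of a cycle, r_ij r_jk = r_ij r_ik + r_ik r_kj
   modulo the ideal, and both terms contain the shorter cycle through i -> k. *)
Lemma cycle_prod_ideal i s : uniq (i :: s) -> s != [::] ->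
  path_prod i s * r (last i s) i \in pvb_ideal n.
Proof.
elim: s => // j [|k s] IH u _ /=.
  by rewrite mulr1 pvb_rel3_ideal //; move: u; rewrite /= inE andbT eq_sym.
have {IH} IH : r i k * path_prod k s * r (last k s) i \in pvb_ideal n.
  by apply: IH => //; move: u => /= /and3P[]; rewrite !inE !negb_or => /andP[_ ->] _ ->.
have ijk : uniq [:: i; j; k].
  by move: u; rewrite /= !inE !negb_or !andbT => /and3P[/and3P[-> -> _] /andP[-> _] _].
have [rel1 _] := pvb_rel12_ideal ijk.
set y := path_prod k s in IH *; set z := r _ i in IH *.
have -> : r i j * (r j k * y) * z =
    r i j * (r i k * y * z) - r k j * (r i k * y * z) - pvb_rel1 i j k * y * z.
  have -> : r i j * (r j k * y) = (r i j * r i k - r k j * r i k - pvb_rel1 i j k) * y.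
    rewrite mulrA; congr (_ * _).
    by rewrite (pvb_rC k j) opprK opprB [RHS]addrC addrA subrK subrK.
  by rewrite !mulrBl !mulrA.
by apply: rpredB; [apply: rpredB; apply: pvb_ideal_mull | do 2!apply: pvb_ideal_mulr].
Qed.

(** The sources are recorded because on a simple path they are distinct, which makes the generators
    distinct. *)
Lemma path_prod_gen S i s : path (arc S) i s ->
  exists t : seq (pvb_index n),
    [/\ {subset t <= S}, map (fun p => (val p).1) t = belast i s &
        \prod_(p <- t) ext_gen p = path_prod i s].
Proof.
elim: s i => [|j s IH] i /=; first by exists [::]; rewrite big_nil.
case/andP=> /arcP[p Sp pE] /IH[t [tS t1 tE]]; exists (p :: t); split.
- by move=> q; rewrite inE => /predU1P[->|/tS].
- by rewrite /= pE t1.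
- by rewrite big_cons tE (pvb_r_gen pE).
Qed.

Lemma ext_swap_neq0 (G : finType) (a b : G) : ext_swap a b != 0.
Proof. by rewrite /ext_swap signr_eq0. Qed.

(** The scalar stays implicit: membership in a subspace depends only on its being nonzero. *)
Lemma ext_monMU (G : finType) (S T : {set G}) :
  exists c : rat, ext_mon S * ext_mon T = c *: ext_mon (S :|: T) /\
    ([disjoint S & T] -> c != 0).
Proof.
rewrite ext_monM /ext_mon_mul; case: ifP => _.
  exists (ext_sign S T); split=> // _; rewrite /ext_sign prodf_seq_neq0.
  apply/allP => a _; apply/implyP => _; rewrite prodf_seq_neq0.
  by apply/allP => b _; rewrite ext_swap_neq0 implybT.
by exists 0; rewrite scale0r.
Qed.

Lemma pair_prod_swap_neq0 (G : finType) (s : seq G) :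
  pair_prod (@ext_swap G) s != 0.
Proof.
elim: s => //= a s IH; rewrite mulf_neq0 // prodf_seq_neq0.
by apply/allP => b _; apply: ext_swap_neq0.
Qed.

(** A cycle can be taken simple; its product lies in the ideal and divides the monomial up to a
    nonzero scalar. *)
Lemma cyclic_mon_ideal S : ~~ acyclic S -> ext_mon S \in pvb_ideal n.
Proof.
case/forall_inPn=> p Sp; rewrite negbK => /connectP[s0 ps0 ls].
case: (shortenP ps0) ls => s ps us _ ls {s0 ps0}.
set i := (val p).2 in ps us ls; have s_neq0 : s != [::].
  by apply: contraTneq (valP p) => s0; rewrite ls s0 /= eqxx.
have [t [tS t1 tE]] := path_prod_gen ps.
have cyc : \prod_(q <- rcons t p) ext_gen q \in pvb_ideal n.
  rewrite big_rcons /= tE -(@pvb_r_gen p (last i s) i) ?cycle_prod_ideal //.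
  by rewrite [LHS]surjective_pairing -ls.
have ut : uniq (rcons t p).
  apply: (@map_uniq _ _ (fun q => (val q).1)).
  by rewrite map_rcons t1 ls -lastI.
have sub : [set:: rcons t p] \subset S.
  by apply/subsetP => q; rewrite inE mem_rcons inE => /predU1P[->|/tS].
move: cyc; rewrite prod_ext_gen // rpredZeq (negPf (pair_prod_swap_neq0 _)) /= => cyc.
have [c [cE c0]] := ext_monMU [set:: rcons t p] (S :\: [set:: rcons t p]).
have : c *: ext_mon S \in pvb_ideal n.
  rewrite -[in ext_mon S](setID S [set:: rcons t p]) (setIidPr sub) -cE.
  exact: pvb_ideal_mulr.
rewrite rpredZeq (negPf (c0 _)) // -setI_eq0; apply/eqP/setP => q.
by rewrite in_setI in_setD in_set0 andbA andbN.
Qed.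

(** * Termination of the rewriting *)

Definition reach S : {set 'I_n * 'I_n} := [set u | connect (arc S) u.1 u.2].

Definition interval S p : {set 'I_n} :=
  [set w | connect (arc S) (val p).1 w && connect (arc S) w (val p).2].

(* Lexicographic: first the number of pairs not in reach S, then the total size
   of the intervals spanned by the arcs of S. *)
Definition forest_measure S : nat :=
  (#|~: reach S| * (#|{: pvb_index n}| * n).+1 + \sum_(p in S) #|interval S p|)%N.

Lemma sum_interval_bound S :
  (\sum_(p in S) #|interval S p| <= #|{: pvb_index n}| * n)%N.
Proof.
apply: leq_trans (_ : (\sum_(p in S) n <= _)%N).
  by apply: leq_sum => p _; rewrite -[leqRHS]card_ord max_card.
by rewrite sum_nat_const leq_mul2r max_card orbT.
Qed.

(** Since the ends of p stay connected, [reach] can only grow. If it grows strictly, the multiplier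
    in the measure outweighs any sum of intervals. If not, all intervals are unchanged and only the
    interval of p is traded for the smaller one of q. *)
Lemma forest_measure_replace S p q :
  p \in S ->
  connect (arc (q |: (S :\ p))) (val p).1 (val p).2 ->
  ~~ connect (arc S) (val q).1 (val q).2 || (#|interval S q| < #|interval S p|)%N ->
  (forest_measure (q |: (S :\ p)) < forest_measure S)%N.
Proof.
set S' := q |: (S :\ p) => Sp cp Hq.
have sub : subrel (connect (arc S)) (connect (arc S')).
  apply: connect_sub => i j /arcP[t St tE].
  have [tp|ntp] := eqVneq t p; first by move: cp; rewrite -tp tE.
  by apply/connect1/arcP; exists t => //; rewrite !inE ntp St orbT.
have subR : reach S \subset reach S'.
  by apply/subsetP => u; rewrite !inE; apply: sub.
have [eR|neR] := @eqVneq {set 'I_n * 'I_n} (reach S) (reach S').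
  rewrite /forest_measure -eR ltn_add2l.
  have eC i j : connect (arc S') i j = connect (arc S) i j.
    by move/setP/(_ (i, j)): eR; rewrite !inE.
  have eI t : interval S' t = interval S t by apply/setP=> w; rewrite !inE !eC.
  under eq_bigr do rewrite eI.
  move: Hq; rewrite -eC connect1 ?arc_mem ?setU11 //= => ltqp.
  rewrite [ltnRHS](big_setD1 p) //= /S'.
  (* If q was already an arc, the sum just loses the interval of p, which is nonempty because it is
     larger than that of q. *)
  have [Sq|nSq] := boolP (q \in S :\ p).
    by rewrite (setUidPr _) ?sub1set // -[ltnLHS]add0n ltn_add2r (leq_ltn_trans _ ltqp).
  by rewrite big_setU1 //= ltn_add2r.
have ltR : (#|~: reach S'| < #|~: reach S|)%N.
  by apply: proper_card; rewrite properEneq setCS subR andbT (inj_eq (@setC_inj _)) eq_sym.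
rewrite /forest_measure.
apply: (@leq_trans (#|~: reach S'|.+1 * (#|{: pvb_index n}| * n).+1)%N).
  by rewrite mulSn addnC ltn_add2r ltnS sum_interval_bound.
by apply: leq_trans (leq_addr _ _); rewrite leq_mul2r ltR orbT.
Qed.

Definition chain_forests d := [set X | chain_forest X & #|X| == d].

(** The ideal is included so that the rewriting takes place in the exterior algebra, before any
    passage to the quotient. *)
Definition forest_span d : {vspace E} :=
  (pvb_ideal n + <<[seq ext_mon X | X in chain_forests d]>>)%VS.

Lemma forest_span_ideal d x : x \in pvb_ideal n -> x \in forest_span d.
Proof. by apply: subvP; apply: addvSl. Qed.

Lemma ext_gen_mon0 (G : finType) (a : G) (R : {set G}) :
  a \in R -> ext_gen a * ext_mon R = 0.
Proof. by move=> Ra; rewrite ext_monM /ext_mon_mul disjoints1 Ra. Qed.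

(** A repeated generator makes the product vanish, so the monomial on the union matters only when it
    has d elements. *)
Lemma gen2_mon_span d p q (R : {set pvb_index n}) :
  (#|R| + 2)%N = d ->
  (#|q |: (p |: R)| = d -> ext_mon (q |: (p |: R)) \in forest_span d) ->
  ext_gen p * ext_gen q * ext_mon R \in forest_span d.
Proof.
move=> cR H; rewrite (ext_genM p q) mulNr rpredN -mulrA.
have [Rp|nRp] := boolP (p \in R); first by rewrite ext_gen_mon0 // mulr0 mem0v.
have [c [-> _]] := ext_monMU [set p] R; rewrite -scalerAr; apply: rpredZ.
have [Rq|nRq] := boolP (q \in p |: R); first by rewrite ext_gen_mon0 ?mem0v.
have [c' [-> _]] := ext_monMU [set q] (p |: R); apply/rpredZ/H.
by rewrite !cardsU1 nRp nRq -cR addn2.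
Qed.

(** After i -> k gives way to j -> k, the vertex k is still reached from i through j. If j reached k
    before, the interval from j to k lies in the one from i to k and misses i, by acyclicity. *)
Lemma out_replace S i j k p q t :
  acyclic S -> val p = (i, j) -> val q = (i, k) -> val t = (j, k) ->
  p \in S -> q \in S -> (forest_measure (t |: (S :\ q)) < forest_measure S)%N.
Proof.
move=> ac pE qE tE Sp Sq.
have pq : p != q.
  by apply: contraTneq (valP t) => epq; move: pE; rewrite epq tE qE => -[->]; rewrite eqxx.
have Spq : p \in S :\ q by rewrite !inE pq.
apply: forest_measure_replace => //.
  rewrite qE; apply: (@connect_trans _ _ j); apply: connect1.
    by rewrite (memP_arc _ pE) inE Spq orbT.
  by rewrite (memP_arc _ tE) setU11.
rewrite -implybE; apply/implyP; rewrite tE => /= cjk.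
apply: proper_card; apply/properP; split.
  apply/subsetP => w; rewrite !inE tE qE /= => /andP[jw ->]; rewrite andbT.
  by apply: connect_trans jw; apply: connect1; rewrite (memP_arc _ pE).
exists i; rewrite !inE ?tE ?qE /= ?connect0 ?andbT.
  by apply: connect1; rewrite (memP_arc _ qE).
rewrite negb_and; apply/orP; left.
by move/acyclicP: ac; apply; rewrite (memP_arc _ pE).
Qed.

(** Dual to [out_replace]: after i -> k gives way to i -> j, the path to k runs through j, and the
    interval from i to j misses k. *)
Lemma in_replace S i j k p q t :
  acyclic S -> val p = (i, k) -> val q = (j, k) -> val t = (i, j) ->
  p \in S -> q \in S -> (forest_measure (t |: (S :\ p)) < forest_measure S)%N.
Proof.
move=> ac pE qE tE Sp Sq.
have pq : q != p.
  by apply: contraTneq (valP t) => epq; move: qE; rewrite epq tE pE => -[->]; rewrite eqxx.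
have Spq : q \in S :\ p by rewrite !inE pq.
apply: forest_measure_replace => //.
  rewrite pE; apply: (@connect_trans _ _ j); apply: connect1.
    by rewrite (memP_arc _ tE) setU11.
  by rewrite (memP_arc _ qE) inE Spq orbT.
rewrite -implybE; apply/implyP; rewrite tE => /= cij.
apply: proper_card; apply/properP; split.
  apply/subsetP => w; rewrite !inE tE pE /= => /andP[-> wj] /=.
  by apply: connect_trans wj _; apply: connect1; rewrite (memP_arc _ qE).
exists k; rewrite !inE ?tE ?pE /= ?connect0 ?andbT.
  by apply: connect1; rewrite (memP_arc _ pE).
rewrite negb_and; apply/orP; right.
by move/acyclicP: ac; apply; rewrite (memP_arc _ qE).
Qed.

Lemma gen2_mon_split S p q : p \in S -> q \in S -> p != q ->
  exists2 c : rat, c != 0 &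
    ext_gen p * ext_gen q * ext_mon (S :\ p :\ q) = c *: ext_mon S.
Proof.
move=> Sp Sq npq; rewrite -mulrA.
have [c [-> c0]] := ext_monMU [set q] (S :\ p :\ q).
have Spq : q \in S :\ p by rewrite !inE eq_sym npq.
rewrite setD1K // -scalerAr.
have [c' [-> c'0]] := ext_monMU [set p] (S :\ p).
rewrite setD1K // scalerA; exists (c * c') => //.
by rewrite mulf_neq0 ?c0 ?c'0 // disjoints1 !inE eqxx.
Qed.

(** Induction on the measure. The first relation resolves two arcs with a common source, the second
    two arcs with a common target; each yields two monomials of smaller measure. *)
Lemma ext_mon_forest_span S : ext_mon S \in forest_span #|S|.
Proof.
have [m] := ubnP (forest_measure S); elim: m S => // m IH S /ltnSE leSm.
set d := #|S|.
have [ac|nac] := boolP (acyclic S); last first.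
  exact/forest_span_ideal/cyclic_mon_ideal.
have {}IH S' : (forest_measure S' < forest_measure S)%N -> #|S'| = d ->
    ext_mon S' \in forest_span d.
  by move=> lt <-; apply: IH; apply: leq_trans leSm.
have sDC p q : S :\ p :\ q = S :\ q :\ p by rewrite !setDDl setUC.
have split p q : p \in S -> q \in S -> p != q ->
    (p |: (S :\ p :\ q) = S :\ q /\ q |: (S :\ p :\ q) = S :\ p /\
     (#|S :\ p :\ q| + 2)%N = d) /\
    (ext_gen p * ext_gen q * ext_mon (S :\ p :\ q) \in forest_span d ->
     ext_mon S \in forest_span d).
  move=> Sp Sq npq; split; last first.
    have [c c0 ->] := gen2_mon_split Sp Sq npq.
    by rewrite rpredZeq (negPf c0).
  have Spq : q \in S :\ p by rewrite !inE eq_sym npq.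
  have Sqp : p \in S :\ q by rewrite !inE npq.
  split; first by rewrite sDC setD1K.
  split; first by rewrite setD1K.
  by rewrite /d (cardsD1 p S) (cardsD1 q (S :\ p)) Sp Spq addnA addnC.
have span1 q p t : p \in S -> q \in S -> p != q ->
   (forest_measure (t |: (S :\ q)) < forest_measure S)%N ->
   ext_gen p * ext_gen t * ext_mon (S :\ p :\ q) \in forest_span d.
  move=> Sp Sq npq lt; have [[e1 [e2 e3]] _] := split p q Sp Sq npq.
  by apply: gen2_mon_span => //; rewrite e1 => cS; apply: IH.
have [oS|] := boolP (out_inj S); last first.
  case/forall_inPn=> p Sp /forall_inPn[q Sq]; rewrite negb_imply => /andP[/eqP e1 npq].
  set i := (val p).1 in e1; set j := (val p).2; set k := (val q).2.
  have pE : val p = (i, j) by rewrite [LHS]surjective_pairing.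
  have qE : val q = (i, k) by rewrite [LHS]surjective_pairing -e1.
  have njk : j != k.
    by apply: contraNneq npq => ejk; apply/eqP/val_inj; rewrite pE qE ejk.
  have [t tE] := pvb_index_ex njk.
  have [t' t'E] : exists t' : pvb_index n, val t' = (k, j).
    by apply: pvb_index_ex; rewrite eq_sym.
  have nij : i != j by have := valP p; rewrite pE.
  have nik : i != k by have := valP q; rewrite qE.
  have [rel1 _] : pvb_rel1 i j k \in pvb_ideal n /\ pvb_rel2 i j k \in pvb_ideal n.
    by apply: pvb_rel12_ideal; rewrite /= !inE negb_or nij nik njk.
  have [[_ [_ _]]] := split p q Sp Sq npq; apply.
  (* In both remaining products one of the two arcs is kept and the other replaced. *)
  have -> : ext_gen p * ext_gen q =
      pvb_rel1 i j k + (ext_gen p * ext_gen t - ext_gen q * ext_gen t').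
    by rewrite /pvb_rel1 (pvb_r_gen pE) (pvb_r_gen qE) (pvb_r_gen tE) (pvb_r_gen t'E) subrK.
  rewrite mulrDl; apply: rpredD; last (rewrite mulrBl; apply: rpredB).
  - exact/forest_span_ideal/pvb_ideal_mulr.
  - by apply: span1; rewrite // 1?eq_sym //; apply: out_replace pE qE tE _ _.
  - rewrite sDC.
    by apply: span1; rewrite // 1?eq_sym //; apply: out_replace qE pE t'E _ _.
have [iS|] := boolP (in_inj S); last first.
  case/forall_inPn=> p Sp /forall_inPn[q Sq]; rewrite negb_imply => /andP[/eqP e2 npq].
  set k := (val p).2 in e2; set i := (val p).1; set j := (val q).1.
  have pE : val p = (i, k) by rewrite [LHS]surjective_pairing.
  have qE : val q = (j, k) by rewrite [LHS]surjective_pairing -e2.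
  have nij : i != j.
    by apply: contraNneq npq => eij; apply/eqP/val_inj; rewrite pE qE eij.
  have [t tE] := pvb_index_ex nij.
  have [t' t'E] : exists t' : pvb_index n, val t' = (j, i).
    by apply: pvb_index_ex; rewrite eq_sym.
  have nik : i != k by have := valP p; rewrite pE.
  have njk : j != k by have := valP q; rewrite qE.
  have [_ rel2] : pvb_rel1 i j k \in pvb_ideal n /\ pvb_rel2 i j k \in pvb_ideal n.
    by apply: pvb_rel12_ideal; rewrite /= !inE negb_or nij nik njk.
  have [[_ [_ _]]] := split p q Sp Sq npq; apply.
  (* The factors of the second relation are swapped so that each product starts with the arc that is
     kept. *)
  have -> : ext_gen p * ext_gen q =
      pvb_rel2 i j k + (ext_gen p * ext_gen t' - ext_gen q * ext_gen t).
    rewrite /pvb_rel2 (pvb_r_gen pE) (pvb_r_gen qE) (pvb_r_gen tE) (pvb_r_gen t'E).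
    by rewrite (ext_genM p t') (ext_genM q t) opprK [- _ + _]addrC subrK.
  rewrite mulrDl; apply: rpredD; last (rewrite mulrBl; apply: rpredB).
  - exact/forest_span_ideal/pvb_ideal_mulr.
  - by apply: span1; rewrite // 1?eq_sym //; apply: in_replace qE pE t'E _ _.
  - rewrite sDC.
    by apply: span1; rewrite // 1?eq_sym //; apply: in_replace pE qE tE _ _.
apply: subvP (addvSr _ _) _ _; apply/memv_span/map_f.
by rewrite mem_enum inE /chain_forest oS iS ac eqxx.
Qed.

End Forests.

(** * Independence of the chain forests *)

Lemma connect_cases_r (T : finType) (e : rel T) x y : connect e x y ->
  x = y \/ exists2 z, connect e x z & e z y.
Proof.
case/connectP=> p; case/lastP: p => [|p z] /=; first by left.
rewrite rcons_path last_rcons => /andP[ep ez] ->; right.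
by exists (last x p) => //; apply/connectP; exists p.
Qed.

Lemma connect_total_out (T : finType) (e : rel T) x y z :
  (forall a b c, e a b -> e a c -> b = c) ->
  connect e x y -> connect e x z -> connect e y z || connect e z y.
Proof.
move=> fe /connectP[p + ->]; elim: p x => [|w p IH] x /=; first by move=> _ ->.
case/andP=> exw pw /connect_cases[<-|[w' exw' w'z]].
  by apply/orP; right; apply/connectP; exists (w :: p); rewrite //= exw.
by apply: IH => //; rewrite (fe _ _ _ exw exw').
Qed.

Lemma connect_total_in (T : finType) (e : rel T) x y z :
  (forall a b c, e a c -> e b c -> a = b) ->
  connect e x z -> connect e y z -> connect e x y || connect e y x.
Proof.
move=> fe; rewrite ![connect e _ _]connect_rev orbC.
by apply: connect_total_out => a b c; apply: fe.
Qed.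

Section LinearForms.

Variable G : finType.
Implicit Types c d : G -> rat.

Definition lin_form c : exterior G := \sum_a c a *: ext_gen a.

Lemma lin_form_anti c d :
  lin_form c * lin_form d = - (lin_form d * lin_form c).
Proof.
rewrite /lin_form mulr_suml [in RHS]mulr_sumr -sumrN; apply: eq_bigr => a _.
rewrite mulr_suml mulr_sumr -sumrN; apply: eq_bigr => b _.
by rewrite -!scalerAl -!scalerAr ext_genM !scalerN scalerA mulrC -scalerA.
Qed.

Lemma lin_form_sqr c : lin_form c * lin_form c = 0.
Proof.
have := lin_form_anti c c; set x := _ * _ => xN.
have : 2%:R *: x = 0 by rewrite scaler_nat mulr2n {1}xN addNr.
by move/eqP; rewrite scaler_eq0 => /eqP.
Qed.

Lemma lin_formB c d : lin_form c - lin_form d = lin_form (fun a => c a - d a).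
Proof. by rewrite -sumrB; apply: eq_bigr => a _; rewrite scalerBl. Qed.

End LinearForms.

(* [lij], [lik], ... compare three elements of a chain, and [dij], [dik], ... are
   differences of three anticommuting square-zero elements. *)
Section ChainRelations.

Variables (R : nzRingType) (lij lji lik ljk lkj : bool) (dij dji dik djk dkj : R).
Local Notation "l ? d" := (if l then d else 0) (at level 20).

(** By transitivity, each of the last two products occurs only together with the first, and then by
    the exclusive or exactly one of them does. It cancels the first, since d_ij d_ik equals both
    d_ij d_jk and - d_ik d_kj. *)
Lemma chain_relation_out :
  (lij && ljk ==> lik) -> (lik && lkj ==> lij) ->
  (lij && lik ==> (ljk (+) lkj)) ->
  dij + djk = dik -> dik + dkj = dij -> dij * dij = 0 -> dik * dik = 0 ->
  dkj * dik = - (dik * dkj) ->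
  (lij ? dij) * (lik ? dik) - ((lij ? dij) * (ljk ? djk) - (lik ? dik) * (lkj ? dkj)) = 0.
Proof.
move=> H1 H2 H3 eik eij sij sik anti.
have out1 : dij * dik = dij * djk by rewrite -eik mulrDr sij add0r.
have out2 : dij * dik = - (dik * dkj) by rewrite -eij mulrDl sik add0r.
case: lij ljk lik lkj H1 H2 H3 => [] [] [] [] //= _ _ _;
  rewrite ?mul0r ?mulr0 ?subr0 ?sub0r ?opprK ?addNr ?oppr0 //.
- by rewrite out1 subrr.
- by rewrite out2 addNr.
Qed.

Lemma chain_relation_in :
  (lij && ljk ==> lik) -> (lji && lik ==> ljk) ->
  (lik && ljk ==> (lij (+) lji)) ->
  dij + djk = dik -> dji + dik = djk -> djk * djk = 0 -> dik * dik = 0 ->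
  dik * dji = - (dji * dik) ->
  (lik ? dik) * (ljk ? djk) - ((lij ? dij) * (ljk ? djk) - (lji ? dji) * (lik ? dik)) = 0.
Proof.
move=> H1 H2 H3 eik ejk sjk sik anti.
have in1 : dik * djk = dij * djk by rewrite -eik mulrDl sjk addr0.
have in2 : dik * djk = - (dji * dik) by rewrite -ejk mulrDr sik addr0.
case: lij lji lik ljk H1 H2 H3 => [] [] [] [] //= _ _ _;
  rewrite ?mul0r ?mulr0 ?subr0 ?sub0r ?opprK ?addNr ?oppr0 //.
- by rewrite in1 subrr.
- by rewrite in2 addNr.
Qed.

End ChainRelations.

Section OrderedForms.

Variables (n : nat) (F : {set pvb_index n}).
Hypothesis chF : chain_forest F.
Implicit Types (i j k : 'I_n) (p q : pvb_index n) (X : {set pvb_index n}).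

Local Notation le := (connect (arc F)).

Let acF : acyclic F. Proof. by case/and3P: chF. Qed.

Let outF i j k : arc F i j -> arc F i k -> j = k.
Proof. by apply: out_inj_arc; case/and3P: chF. Qed.

Let inF i j k : arc F i k -> arc F j k -> i = j.
Proof. by apply: in_inj_arc; case/and3P: chF. Qed.

Definition down_sum i : exterior 'I_n := lin_form (fun l => (le l i)%:R).

Definition order_form i j : exterior 'I_n :=
  if le i j then down_sum j - down_sum i else 0.

Definition order_map : exterior (pvb_index n) -> exterior 'I_n :=
  ext_lift (fun p : pvb_index n => order_form (val p).1 (val p).2).

HB.instance Definition _ := GRing.Linear.on order_map.

Lemma order_formE i j :
  order_form i j = lin_form (fun l => if le i j then (le l j)%:R - (le l i)%:R else 0).
Proof.
rewrite /order_form; case: ifP => _; first exact: lin_formB.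
by rewrite /lin_form big1 // => l _; rewrite scale0r.
Qed.

Lemma order_form_anti i j k l :
  order_form i j * order_form k l = - (order_form k l * order_form i j).
Proof. by rewrite !order_formE lin_form_anti. Qed.

Lemma order_map_monoid : monoid_morphism order_map.
Proof.
apply: ext_lift_monoid => [p|p q]; last exact: order_form_anti.
by rewrite order_formE lin_form_sqr.
Qed.

Lemma order_map_r i j : order_map (pvb_r i j) = order_form i j.
Proof.
have [<-|neij] := eqVneq i j.
  by rewrite /pvb_r insubN /= ?eqxx // linear0 /order_form subrr if_same.
have [p pE] := pvb_index_ex neij.
by rewrite (pvb_r_gen pE) /order_map ext_lift_gen pE.
Qed.

Let D i j := down_sum j - down_sum i.

Let D_anti i j k l : D i j * D k l = - (D k l * D i j).
Proof. by rewrite /D !lin_formB lin_form_anti. Qed.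

Let D_sqr i j : D i j * D i j = 0.
Proof. by rewrite /D !lin_formB lin_form_sqr. Qed.

Let DD i j k : D i j + D j k = D i k.
Proof. by rewrite addrC /D addrA subrK. Qed.

Lemma order_map_rel1 i j k : j != k -> order_map (pvb_rel1 i j k) = 0.
Proof.
move=> njk; have [_ oM] := order_map_monoid.
rewrite /pvb_rel1 2!linearB /= !oM !order_map_r /order_form -!/(D _ _).
apply: chain_relation_out => //.
- by apply/implyP=> /andP[]; apply: connect_trans.
- by apply/implyP=> /andP[]; apply: connect_trans.
apply/implyP=> /andP[lij lik]; case/orP: (connect_total_out outF lij lik) => l.
  by rewrite l /=; apply: contraNN njk => l'; rewrite (acyclic_anti acF l l').
by rewrite l addbT; apply: contraNN njk => l'; rewrite (acyclic_anti acF l' l).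
Qed.

Lemma order_map_rel2 i j k : i != j -> order_map (pvb_rel2 i j k) = 0.
Proof.
move=> nij; have [_ oM] := order_map_monoid.
rewrite /pvb_rel2 2!linearB /= !oM !order_map_r /order_form -!/(D _ _).
apply: chain_relation_in => //.
- by apply/implyP=> /andP[]; apply: connect_trans.
- by apply/implyP=> /andP[]; apply: connect_trans.
apply/implyP=> /andP[lik ljk]; case/orP: (connect_total_in inF lik ljk) => l.
  by rewrite l /=; apply: contraNN nij => l'; rewrite (acyclic_anti acF l l').
by rewrite l addbT; apply: contraNN nij => l'; rewrite (acyclic_anti acF l' l).
Qed.

Lemma order_map_rel3 i j : i != j -> order_map (pvb_rel3 i j) = 0.
Proof.
move=> nij; have [_ oM] := order_map_monoid.
rewrite /pvb_rel3 oM !order_map_r /order_form.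
case lij: (le i j); last by rewrite mul0r.
case lji: (le j i); last by rewrite mulr0.
by rewrite (acyclic_anti acF lij lji) eqxx in nij.
Qed.

Lemma order_map_ideal x : x \in pvb_ideal n -> order_map x = 0.
Proof.
have [_ oM] := order_map_monoid.
suff /subvP sub : (pvb_ideal n <= lker (linfun order_map))%VS.
  by move/sub; rewrite memv_ker lfunE => /eqP.
have memK y : order_map y = 0 -> (<[y]> <= lker (linfun order_map))%VS.
  by move=> y0; rewrite -memvE memv_ker lfunE /= y0.
have Rsub : (pvb_relations n <= lker (linfun order_map))%VS.
  apply/subv_sumP => i _; apply/subv_sumP => j neji; rewrite subv_add.
  apply/andP; split; first by apply/memK/order_map_rel3; rewrite eq_sym.
  apply/subv_sumP => k; rewrite /= !inE negb_or => /and3P[/andP[nij nik] njk _].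
  rewrite subv_add; apply/andP; split; apply: memK.
    exact: order_map_rel1.
  exact: order_map_rel2.
apply/prodvP => y z /= yI _; rewrite memv_ker lfunE /= oM.
suff : y \in lker (linfun order_map) by rewrite memv_ker lfunE => /eqP/= ->; rewrite mul0r.
move: y yI; apply/subvP/prodvP => u v _ /(subvP Rsub).
by rewrite !memv_ker !lfunE /= oM => /eqP->; rewrite mulr0.
Qed.

Let rk i := #|[set l | le l i]|.

(** No other arc enters j, so j itself is the only ancestor of j that is not one of i. *)
Let rk_arc i j : arc F i j -> rk j = (rk i).+1.
Proof.
move=> aij; rewrite /rk.
have -> : [set l | le l j] = j |: [set l | le l i].
  apply/setP=> l; rewrite !inE; apply/idP/predU1P => [|[->|li]].
  - case/connect_cases_r=> [->|[m lm mj]]; first by left.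
    by right; rewrite (inF aij mj).
  - exact: connect0.
  - exact/(connect_trans li)/connect1.
by rewrite cardsU1 inE (acyclicP _ acF).
Qed.

Let rk_mono i j : le i j -> (rk i <= rk j)%N.
Proof.
by move=> lij; apply/subset_leq_card/subsetP=> l; rewrite !inE => /connect_trans; apply.
Qed.

Let rk_strict i j : i != j -> le i j -> (rk i < rk j)%N.
Proof.
move=> nij /connect_cases[eij|[m /rk_arc im /rk_mono]]; last by rewrite im.
by rewrite eij eqxx in nij.
Qed.

Let card_src X : chain_forest X -> #|[set (val p).1 | p in X]| = #|X|.
Proof. by case/and3P=> /out_injP inj _ _; apply: card_in_imset. Qed.

Let card_tgt X : chain_forest X -> #|[set (val p).2 | p in X]| = #|X|.
Proof. by case/and3P=> _ /in_injP inj _; apply: card_in_imset. Qed.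

(* X and F have the same sources and the same targets; summing the ranks over
   them, each arc of X raises the rank by exactly 1, hence is an arc of F. *)
Lemma chain_forest_order_uniq X : chain_forest X -> #|X| = #|F| ->
  {in X, forall p, le (val p).1 (val p).2} -> X = F.
Proof.
move=> chX cX leX.
have srcE : [set (val p).1 | p in X] = [set (val p).1 | p in F].
  apply/eqP; rewrite eqEcard !card_src // cX leqnn andbT.
  apply/subsetP=> _ /imsetP[p Xp ->].
  case/connect_cases: (leX p Xp) => [e|[m /arcP[q Fq qE] _]].
    by have := valP p; rewrite e eqxx.
  by apply/imsetP; exists q; rewrite ?qE.
have tgtE : [set (val p).2 | p in X] = [set (val p).2 | p in F].
  apply/eqP; rewrite eqEcard !card_tgt // cX leqnn andbT.
  apply/subsetP=> _ /imsetP[p Xp ->].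
  case/connect_cases_r: (leX p Xp) => [e|[m _ /arcP[q Fq qE]]].
    by have := valP p; rewrite e eqxx.
  by apply/imsetP; exists q; rewrite ?qE.
have sum_src Y (g : 'I_n -> nat) : chain_forest Y ->
    (\sum_(p in Y) g (val p).1 = \sum_(i in [set (val p).1 | p in Y]) g i)%N.
  by case/and3P=> /out_injP inj _ _; rewrite big_imset.
have sum_tgt Y (g : 'I_n -> nat) : chain_forest Y ->
    (\sum_(p in Y) g (val p).2 = \sum_(i in [set (val p).2 | p in Y]) g i)%N.
  by case/and3P=> _ /in_injP inj _; rewrite big_imset.
have lt_rk p : p \in X -> (rk (val p).1 < rk (val p).2)%N.
  by move=> Xp; apply: rk_strict (leX p Xp); apply: valP p.
have sumE : (\sum_(p in X) (rk (val p).1).+1 = \sum_(p in X) rk (val p).2)%N.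
  rewrite sum_tgt // tgtE -sum_tgt // (sum_src _ (fun i => (rk i).+1)) // srcE.
  rewrite -(sum_src _ (fun i => (rk i).+1)) //; apply: eq_bigr => p Fp.
  by rewrite (rk_arc (arc_mem Fp)).
have rk1 p : p \in X -> rk (val p).2 = (rk (val p).1).+1.
  have lf q : q \in X -> ((rk (val q).1).+1 <= rk (val q).2
      ?= iff ((rk (val q).1).+1 == rk (val q).2))%N.
    by move=> Xq; split; first exact: lt_rk.
  have [_] := leqif_sum lf; rewrite sumE eqxx => /esym/forall_inP H Xp.
  exact/esym/eqP/H.
apply/eqP; rewrite eqEcard cX leqnn andbT; apply/subsetP=> p Xp.
case/connect_cases: (leX p Xp) => [e|[m am lem]].
  by have := valP p; rewrite e eqxx.
have [em|nem] := eqVneq m (val p).2.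
  by rewrite -(memP_arc F (surjective_pairing (val p))) -em.
by have := rk_strict nem lem; rewrite (rk_arc am) rk1 // ltnn.
Qed.

Lemma order_map_mon_neq0 X : chain_forest X -> #|X| = #|F| ->
  order_map (ext_mon X) != 0 -> X = F.
Proof.
move=> chX cX nz; apply: chain_forest_order_uniq => // p Xp.
apply: contraNT nz => nle; rewrite /order_map ext_lift_mon.
have : p \in enum X by rewrite mem_enum.
case/splitPr=> s1 s2; rewrite big_cat big_cons /= {2}/order_form (negPf nle).
by rewrite mul0r mulr0.
Qed.

(** Along an arc i -> j of F the two down sums differ by the generator of j alone, so the image is,
    up to sign, the monomial of the heads of F, which are distinct. *)
Lemma order_map_self : order_map (ext_mon F) != 0.
Proof.
rewrite /order_map ext_lift_mon big_seq.
under eq_bigr => p Fp.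
  have arcp := arc_mem (eq_ind _ is_true Fp _ (mem_enum _ _)).
  have -> : order_form (val p).1 (val p).2 = ext_gen (val p).2.
    rewrite /order_form connect1 // -sumrB (bigD1 (val p).2) //= big1.
      rewrite connect0 (negPf (acyclicP _ acF _ _ arcp)) scale1r scale0r.
      by rewrite subr0 addr0.
    move=> l nl; suff -> : le l (val p).2 = le l (val p).1 by rewrite subrr.
    apply/idP/idP=> [/connect_cases_r[e|[m lm /(inF arcp) ->//]]|li].
      by rewrite e eqxx in nl.
    exact/(connect_trans li)/connect1.
  over.
rewrite -big_seq -(big_map (fun p : pvb_index n => (val p).2) predT (@ext_gen _)).
have inj : {in F &, injective (fun p => (val p).2)}.
  by apply/in_injP; case/and3P: chF.
rewrite prod_ext_gen; last first.
  by rewrite map_inj_in_uniq ?enum_uniq // => p q; rewrite !mem_enum; apply: inj.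
rewrite scaler_eq0 (negPf (pair_prod_swap_neq0 _)) /=.
apply/eqP=> /ffunP/(_ [set:: [seq (val p).2 | p <- enum F]])/eqP.
by rewrite !ffunE eqxx oner_eq0.
Qed.

End OrderedForms.

(** * The chain forest basis and traces *)

(** Expanding either basis in the other leads to the same double sum of coordinates: this is tr(AB)
    = tr(BA). *)
Lemma trace_on_basis (K : fieldType) (V : vectType K) (U : {vspace V})
    (f : 'End(V)) m (b : m.-tuple V) :
  basis_of U b -> (f @: U <= U)%VS ->
  trace_on U f = \sum_(i < m) coord b i (f b`_i).
Proof.
move=> bU fU; have vU := vbasisP U.
have memU i : f (vbasis U)`_i \in U.
  case: (ltnP i (\dim U)) => lti; last first.
    by rewrite nth_default ?size_tuple // linear0 mem0v.
  by apply: subvP fU _ _; rewrite memv_img // vbasis_mem // mem_nth // size_tuple.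
have fE i : (i < \dim U)%N -> (vbasis U)`_i = \sum_(j < m) coord b j (vbasis U)`_i *: b`_j.
  by move=> lti; rewrite -(coord_basis bU) // vbasis_mem // mem_nth // size_tuple.
have bmem (j : 'I_m) : f b`_j \in U.
  apply: subvP fU _ _; rewrite memv_img // (basis_mem bU) // mem_nth //.
  by rewrite size_tuple.
rewrite /trace_on; under eq_bigr => i _ do
  rewrite (fE i (ltn_ord i)) !linear_sum /=.
rewrite exchange_big /=; apply: eq_bigr => j _.
rewrite [in RHS](coord_basis vU (bmem j)) linear_sum; apply: eq_bigr => i _.
by rewrite !linearZ /= mulrC.
Qed.

Section ForestBasis.

Variable n : nat.
Implicit Types (i j k : 'I_n) (p q : pvb_index n) (S X : {set pvb_index n}).

Local Notation pi := (quotv_pi (pvb_ideal n)).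

Definition forest_basis d : #|chain_forests n d|.-tuple (pvb n) :=
  [tuple pi (ext_mon (enum_val i)) | i < #|chain_forests n d|].

Lemma forest_basisE d (i : 'I_#|chain_forests n d|) :
  (forest_basis d)`_i = pi (ext_mon (enum_val i)).
Proof. by rewrite -tnth_nth tnth_mktuple. Qed.

Lemma forest_basis_free d : free (forest_basis d).
Proof.
apply/freeP=> c; under eq_bigr do rewrite forest_basisE.
move=> c0 i; have := enum_valP i; rewrite inE => /andP[chF /eqP cF].
set F := enum_val i in chF cF.
have : \sum_(j < #|chain_forests n d|) c j *: ext_mon (enum_val j) \in pvb_ideal n.
  by rewrite -quotv_pi_eq0 linear_sum -[X in _ == X]c0; apply/eqP/eq_bigr => j _; rewrite linearZ.
move/(order_map_ideal chF); rewrite linear_sum /= (bigD1 i) //= big1 => [|j neji].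
  rewrite addr0 linearZ /= => /eqP; rewrite scaler_eq0.
  by rewrite (negPf (order_map_self chF)) orbF => /eqP.
rewrite linearZ /=; have := enum_valP j; rewrite inE => /andP[chX /eqP cX].
case: (boolP (order_map F (ext_mon (enum_val j)) == 0)) => [/eqP->|].
  by rewrite scaler0.
move/(order_map_mon_neq0 chF chX); rewrite cX cF => /(_ erefl) XF.
by rewrite (enum_val_inj XF) eqxx in neji.
Qed.

Lemma forest_basis_span d S : #|S| = d -> pi (ext_mon S) \in <<forest_basis d>>%VS.
Proof.
move=> cS; have := ext_mon_forest_span S; rewrite cS.
case/memv_addP=> u uI [v vX ->]; rewrite linearD /=.
have /eqP-> : pi u == 0 by rewrite quotv_pi_eq0.
rewrite add0r; have : pi v \in (pi @: <<[seq ext_mon X | X in chain_forests n d]>>)%VS.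
  exact: memv_img.
apply: subvP; rewrite limg_span; apply/span_subvP => _ /mapP[_ /mapP[X XF ->] ->].
rewrite mem_enum in XF; apply: memv_span.
by rewrite -(enum_rankK_in XF XF) -forest_basisE mem_nth // size_tuple.
Qed.

Lemma forest_basisP d : basis_of (pvb_deg n d) (forest_basis d).
Proof.
rewrite /basis_of forest_basis_free andbT eqEsubv; apply/andP; split.
  apply/span_subvP=> _ /tnthP[i ->]; rewrite tnth_mktuple; apply/memv_img/memv_span.
  by apply/map_f; rewrite mem_enum inE; have := enum_valP i; rewrite inE => /andP[].
rewrite /pvb_deg limg_span; apply/span_subvP => _ /mapP[_ /mapP[X XF ->] ->].
by apply: forest_basis_span; move: XF; rewrite mem_enum inE => /eqP.
Qed.

Lemma dim_pvb_deg d : \dim (pvb_deg n d) = #|chain_forests n d|.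
Proof. by rewrite -(span_basis (forest_basisP d)) (eqP (forest_basis_free d)) size_tuple. Qed.

End ForestBasis.

Lemma card_ancestors_arc n (S : {set pvb_index n}) i j : acyclic S -> arc S i j ->
  (#|[set l | connect (arc S) l i]| < #|[set l | connect (arc S) l j]|)%N.
Proof.
move=> acS aij; apply/proper_card/properP; split.
  by apply/subsetP=> l; rewrite !inE => li; apply/(connect_trans li)/connect1.
by exists j; rewrite !inE ?connect0 // (acyclicP _ acS).
Qed.

Lemma acyclic_rank_ex n (S : {set pvb_index n}) : acyclic S ->
  exists rk : 'I_n -> nat, forall i j, arc S i j -> (rk i < rk j)%N.
Proof.
by move=> acS; exists (fun i => #|[set l | connect (arc S) l i]|) => i j;
  apply: card_ancestors_arc.
Qed.

(** * Action of a permutation on the forest basis *)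

Section Action.

Variables (n : nat) (s : 'S_n).
Implicit Types (i j k : 'I_n) (p q : pvb_index n) (S X : {set pvb_index n}).

Local Notation g := (pvb_index_act s).

(** The inversion sign of the image arcs, listed in the order of their preimages; for invariant S it
    is the eigenvalue of the monomial. *)
Definition act_sign S : rat := pair_prod (@ext_swap _) (map g (enum S)).

Lemma pvb_ext_act_mon S : pvb_ext_act s (ext_mon S) = act_sign S *: ext_mon (g @: S).
Proof.
rewrite pvb_ext_actE ext_lift_mon -(big_map g predT (@ext_gen _)).
rewrite prod_ext_gen ?(map_inj_uniq (@pvb_index_act_inj _ s)) ?enum_uniq //.
congr (_ *: ext_mon _); apply/setP=> p; rewrite inE.
by apply/mapP/imsetP => -[q]; rewrite ?mem_enum => Sq ->; exists q; rewrite ?mem_enum.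
Qed.

Lemma arc_act S i j : arc (g @: S) (s i) (s j) = arc S i j.
Proof.
apply/arcP/arcP => [[_ /imsetP[p Sp ->] []]|[p Sp pE]].
  move=> /perm_inj e1 /perm_inj e2; exists p => //.
  by rewrite [LHS]surjective_pairing e1 e2.
by exists (g p); rewrite ?imset_f //= pE.
Qed.

Lemma chain_forest_act S : chain_forest S -> chain_forest (g @: S).
Proof.
case/and3P=> /out_injP oS /in_injP iS acS; apply/and3P; split.
- apply/out_injP => _ _ /imsetP[p Sp ->] /imsetP[q Sq ->] /perm_inj pq.
  by rewrite (oS p q).
- apply/in_injP => _ _ /imsetP[p Sp ->] /imsetP[q Sq ->] /perm_inj pq.
  by rewrite (iS p q).
have [rk rkS] := acyclic_rank_ex acS.
apply: (@acyclic_rank _ _ (fun i => rk (s^-1 i)%g)) => i j.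
by rewrite -{1}[i](permKV s) -{1}[j](permKV s) arc_act => /rkS.
Qed.

Lemma pvb_act_forest_deg (d : nat) :
  (pvb_act s @: pvb_deg n d <= pvb_deg n d)%VS.
Proof.
rewrite -{1}(span_basis (forest_basisP n d)) limg_span.
apply/span_subvP=> _ /mapP[_ /tnthP[i ->] ->].
have := enum_valP i; rewrite inE => /andP[_ /eqP cF].
rewrite tnth_mktuple pvb_actE pvb_ext_act_mon linearZ rpredZ //.
rewrite -(span_basis (forest_basisP n d)); apply: forest_basis_span.
by rewrite card_imset //; apply: pvb_index_act_inj.
Qed.

Lemma trace_pvb_deg d : trace_on (pvb_deg n d) (pvb_act s) =
  \sum_(X in chain_forests n d | g @: X == X) act_sign X.
Proof.
rewrite (trace_on_basis (forest_basisP n d) (pvb_act_forest_deg d)).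
rewrite [RHS]big_mkcondr [RHS]big_enum_val; apply: eq_bigr => i _ /=.
set F := enum_val i; have := enum_valP i; rewrite -/F inE => /andP[chF /eqP cF].
rewrite forest_basisE pvb_actE pvb_ext_act_mon !linearZ /=.
have gF : g @: F \in chain_forests n d.
  by rewrite inE chain_forest_act // card_imset ?cF ?eqxx //; apply: pvb_index_act_inj.
rewrite -{1}(enum_rankK_in gF gF) -forest_basisE.
rewrite coord_free ?forest_basis_free // -(inj_eq enum_val_inj) enum_rankK_in // -/F.
by case: eqP => _; rewrite ?mulr1 ?mulr0.
Qed.

Lemma card_forest_le X : chain_forest X -> (#|X| <= n)%N.
Proof.
case/and3P=> /out_injP inj _ _.
by rewrite -(card_in_imset inj) -[leqRHS]card_ord max_card.
Qed.

Lemma pvb_char_forests : pvb_char s =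
  \sum_(X | chain_forest X && (g @: X == X)) act_sign X *: 'X^#|X|.
Proof.
rewrite /pvb_char poly_def.
rewrite (partition_big (fun X => inord #|X| : 'I_#|pvb_index n|.+1) predT) //=.
apply: eq_bigr => d _; rewrite trace_pvb_deg scaler_suml.
apply: eq_big => [X|X /andP[]]; last by rewrite inE => /andP[_ /eqP->].
rewrite inE andbAC; congr (_ && _).
by rewrite -val_eqE /= inordK // ltnS max_card.
Qed.

End Action.

Lemma pvb_hilbert_forests n :
  pvb_hilbert n = \sum_(X : {set pvb_index n} | chain_forest X) 'X^#|X|.
Proof.
rewrite /pvb_hilbert poly_def.
rewrite (partition_big (fun X : {set pvb_index n} => inord #|X| : 'I_#|pvb_index n|.+1) predT) //=.
apply: eq_bigr => d _; rewrite dim_pvb_deg scaler_nat -sumr_const.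
apply: eq_big => [X|X]; last by rewrite inE => /andP[_ /eqP->].
rewrite inE; congr (_ && _).
by rewrite -val_eqE /= inordK // ltnS max_card.
Qed.

(** * Signs on invariant forests *)

Lemma card_porbit_gt0 (T : finType) (s : {perm T}) x : (0 < #|porbit s x|)%N.
Proof. by apply/card_gt0P; exists x; apply: porbit_id. Qed.

Lemma expg_porbit (T : finType) (s : {perm T}) x m :
  (((s ^+ m)%g x == x) = (#|porbit s x| %| m))%N.
Proof.
set k := #|porbit s x|.
have k0 : (0 < k)%N by apply: card_porbit_gt0.
have sk q : ((s ^+ (q * k)) x = x)%g.
  elim: q => [|q IH]; first by rewrite mul0n expg0 perm1.
  by rewrite mulSn expgD permM [(s ^+ k)%g x]permX iter_porbit IH.
rewrite {1}(divn_eq m k) expgD permM sk /dvdn.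
have ltr : (m %% k < k)%N by rewrite ltn_mod.
have := uniq_traject_porbit s x; rewrite -/k => u.
rewrite -[in RHS](nth_uniq x _ _ u) ?size_traject ?ltr ?k0 //.
by rewrite !nth_traject // permX.
Qed.

(** Whether two powers of s agree at a point depends only on their exponents modulo its cycle
    length. *)
Lemma expg_porbit_eq (T : finType) (s : {perm T}) x y m1 m2 :
  #|porbit s x| = #|porbit s y| ->
  ((s ^+ m1) x = (s ^+ m2) x)%g -> ((s ^+ m1) y = (s ^+ m2) y)%g.
Proof.
move=> exy; wlog le12 : m1 m2 / (m1 <= m2)%N.
  by move=> W; case: (leqP m1 m2) => [/W //|/ltnW/W H] /esym/H.
rewrite -(subnK le12) expgD !permM => /perm_inj/esym/eqP.
by rewrite expg_porbit exy -expg_porbit => /eqP->.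
Qed.

Section ActionSigns.

Variables (n : nat) (s : 'S_n).
Implicit Types (i j : 'I_n) (p q : pvb_index n) (S T X : {set pvb_index n}).

Local Notation g := (pvb_index_act s).

Definition arc_perm : {perm pvb_index n} := perm (@pvb_index_act_inj n s).

Lemma arc_permE p : arc_perm p = g p. Proof. exact: permE. Qed.

Lemma val_arc_permX m p :
  val ((arc_perm ^+ m)%g p) = ((s ^+ m)%g (val p).1, (s ^+ m)%g (val p).2).
Proof.
elim: m => [|m IH]; first by rewrite !expg0 !perm1 -surjective_pairing.
by rewrite !expgSr !permM arc_permE /= IH.
Qed.

Lemma act_sign0 : act_sign s set0 = 1.
Proof. by rewrite /act_sign enum_set0. Qed.

(** The product of the two monomials is a nonzero multiple of that of the union. Apply the
    multiplicative action to it: by invariance the same scalar appears on both sides and cancels. *)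
Lemma act_signU S T : [disjoint S & T] -> g @: S = S -> g @: T = T ->
  act_sign s (S :|: T) = act_sign s S * act_sign s T.
Proof.
move=> dST gS gT; have [_ aM] := pvb_ext_act_monoid s.
have [c [cE /(_ dST) c0]] := ext_monMU S T.
have := aM (ext_mon S) (ext_mon T).
rewrite cE linearZ /= !pvb_ext_act_mon imsetU gS gT -scalerAl -scalerAr cE !scalerA.
move/ffunP/(_ (S :|: T)); rewrite !ffunE eqxx.
rewrite ![_ *: _]mulr1 => H; apply: (mulfI c0); rewrite H; ring.
Qed.

Lemma act_invP S : reflect (forall p, (g p \in S) = (p \in S)) (g @: S == S).
Proof.
apply: (iffP eqP) => [gS p|gS]; first by rewrite -{1}gS mem_imset //; apply: pvb_index_act_inj.
apply/eqP; rewrite eqEcard card_imset ?leqnn ?andbT; last exact: pvb_index_act_inj.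
by apply/subsetP=> _ /imsetP[p Sp ->]; rewrite gS.
Qed.

Lemma act_inv_expg S p m : g @: S = S -> ((arc_perm ^+ m)%g p \in S) = (p \in S).
Proof.
move/eqP/act_invP=> gS; elim: m => [|m IH]; first by rewrite expg0 perm1.
by rewrite expgSr permM arc_permE gS.
Qed.

Lemma act_inv_porbit p : g @: porbit arc_perm p = porbit arc_perm p.
Proof.
apply/eqP/act_invP => q; rewrite -arc_permE.
rewrite !(porbit_sym arc_perm _ p) -[arc_perm q]/(aperm q arc_perm).
by have := porbit_perm arc_perm 1 q; rewrite expg1 => ->.
Qed.

(** Listed as p, g p, g (g p), ..., the orbit is rotated one step by the action; bringing p back to
    the front passes all the other arcs. *)
Lemma act_sign_porbit p :
  act_sign s (porbit arc_perm p) = (-1) ^+ #|porbit arc_perm p|.-1.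
Proof.
set O := porbit arc_perm p; set k := #|O|.
have k0 : (0 < k)%N by apply: card_porbit_gt0.
have tO : [set:: traject arc_perm p k] = O.
  by apply/setP=> q; rewrite inE porbit_traject.
have := prod_ext_gen (uniq_traject_porbit arc_perm p); rewrite -/O -/k tO.
set c := pair_prod _ _ => cE.
have c0 : c != 0 by apply: pair_prod_swap_neq0.
have := congr1 (pvb_ext_act s) cE; rewrite linearZ /= pvb_ext_act_mon act_inv_porbit -/O.
rewrite pvb_ext_actE (ext_lift_prod_gen (@pvb_index_act_inj _ s)).
have -> : \prod_(a <- traject arc_perm p k) ext_gen (g a) =
    (-1) ^+ k.-1 * \prod_(a <- traject arc_perm p k) ext_gen a.
  rewrite -(big_map g predT (@ext_gen _)).
  have -> : map g (traject arc_perm p k) = traject arc_perm (arc_perm p) k.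
    by elim: (k) (p) => //= m IH q; rewrite -arc_permE IH.
  have pk : iter k.-1.+1 arc_perm p = p by rewrite prednK // iter_porbit.
  rewrite -[k in traject _ _ k](prednK k0) trajectSr -iterSr pk.
  rewrite -[k in RHS](prednK k0) /= -cats1 (prod_anticomm_front (@ext_genM _)).
  by rewrite size_traject cats0 big_cons.
rewrite cE; have -> (x : exterior (pvb_index n)) : (-1) ^+ k.-1 * x = ((-1) ^+ k.-1 : rat) *: x.
  by rewrite -[in RHS]signr_odd scaler_sign -signr_odd mulr_sign.
rewrite !scalerA => /ffunP/(_ O); rewrite !ffunE eqxx ![_ *: _]mulr1 => H.
by apply: (mulfI c0); rewrite -H mulrC.
Qed.

(** Orbits are peeled off one at a time, and d counts them. *)
Lemma act_sign_homogeneous k S : g @: S = S ->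
  {in S, forall p, #|porbit arc_perm p| = k} ->
  exists d : nat, #|S| = (k * d)%N /\ act_sign s S = (-1) ^+ (k.-1 * d).
Proof.
have [m] := ubnP #|S|; elim: m S => // m IH S /ltnSE leSm gS Sk.
have [->|[p Sp]] := set_0Vmem S.
  by exists 0; rewrite cards0 !muln0 act_sign0.
set O := porbit arc_perm p.
have OS : O \subset S.
  by apply/subsetP=> _ /porbitP[x ->]; rewrite act_inv_expg.
have gO : g @: O = O by apply: act_inv_porbit.
have gD : g @: (S :\: O) = S :\: O.
  apply/eqP/act_invP=> q; rewrite !inE.
  by move/eqP/act_invP: gO => ->; move/eqP/act_invP: gS => ->.
have cS : #|S| = (#|O| + #|S :\: O|)%N by rewrite -{1}(setIidPr OS) cardsID.
have O0 : (0 < #|O|)%N by apply: card_porbit_gt0.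
have ltD : (#|S :\: O| < m)%N.
  by apply: leq_trans leSm; rewrite cS -[ltnLHS]add0n ltn_add2r.
have kD : {in S :\: O, forall q, #|porbit arc_perm q| = k}.
  by move=> q; rewrite inE => /andP[_ /Sk].
have [d [dE sE]] := IH (S :\: O) ltD gD kD.
exists d.+1; rewrite mulnS -(Sk p Sp) -/O cS dE (Sk p Sp); split=> //.
rewrite -(setID S O) (setIidPr OS) act_signU //; last first.
  by rewrite -setI_eq0 setIDA setDIl setDv set0I.
by rewrite act_sign_porbit -/O (Sk p Sp) sE mulnS exprD.
Qed.

End ActionSigns.

(** * Factorization over the cycle lengths *)

Lemma chain_forest_sub n (S T : {set pvb_index n}) :
  S \subset T -> chain_forest T -> chain_forest S.
Proof.
move=> /subsetP ST /and3P[/out_injP oT /in_injP iT /acyclic_rank_ex[rk rkT]].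
apply/and3P; split.
- by apply/out_injP => p q /ST Tp /ST Tq; apply: oT.
- by apply/in_injP => p q /ST Tp /ST Tq; apply: iT.
apply: (@acyclic_rank _ _ rk) => i j /arcP[p /ST Tp pE].
by apply: rkT; rewrite (memP_arc _ pE).
Qed.

Lemma chain_forest0 n : chain_forest (set0 : {set pvb_index n}).
Proof.
apply/and3P; split; [apply/out_injP|apply/in_injP|apply: (@acyclic_rank _ _ (fun=> 0%N))].
- by move=> p q; rewrite inE.
- by move=> p q; rewrite inE.
by move=> i j /arcP[p]; rewrite inE.
Qed.

Section Factorization.

Variables (n : nat) (s : 'S_n).
Implicit Types (i j : 'I_n) (p q : pvb_index n) (S T X Y : {set pvb_index n}).

Local Notation g := (pvb_index_act s).
Local Notation clen i := #|porbit s i|.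

Lemma card_porbit_act i : clen (s i) = clen i.
Proof. by have := porbit_perm s 1 i; rewrite expg1 => ->. Qed.

Definition inv_forest X := chain_forest X && (g @: X == X).

Lemma inv_forest_chain X : inv_forest X -> chain_forest X.
Proof. by case/andP. Qed.

Lemma inv_forest_act X : inv_forest X -> g @: X = X.
Proof. by case/andP=> _ /eqP. Qed.

(** A power of s that fixes the head of an arc maps it to an arc of X with the same head, hence to
    itself, and so fixes the tail too; the same holds with head and tail exchanged. Thus the two
    cycle lengths divide each other. *)
Lemma inv_forest_ends X p : inv_forest X -> p \in X ->
  clen (val p).1 = clen (val p).2.
Proof.
case/andP=> /and3P[/out_injP oX /in_injP iX _] /eqP gX Xp.
apply/eqP; rewrite eqn_dvd; apply/andP; split.
  have E2 := expg_porbit s (val p).2 #|porbit s (val p).2|.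
  rewrite dvdnn in E2; have := eqP E2 => e2.
  have : (arc_perm s ^+ #|porbit s (val p).2|)%g p = p.
    by apply: iX; rewrite ?act_inv_expg // val_arc_permX.
  by move/(congr1 (fun q => (val q).1)); rewrite val_arc_permX -expg_porbit => /eqP.
have E1 := expg_porbit s (val p).1 #|porbit s (val p).1|.
rewrite dvdnn in E1; have := eqP E1 => e1.
have : (arc_perm s ^+ #|porbit s (val p).1|)%g p = p.
  by apply: oX; rewrite ?act_inv_expg // val_arc_permX.
by move/(congr1 (fun q => (val q).2)); rewrite val_arc_permX -expg_porbit => /eqP.
Qed.

Lemma card_arc_porbit p : clen (val p).1 = clen (val p).2 ->
  #|porbit (arc_perm s) p| = clen (val p).1.
Proof.
move=> e; have dE m : (#|porbit (arc_perm s) p| %| m)%N = (clen (val p).1 %| m)%N.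
  rewrite -expg_porbit -val_eqE val_arc_permX [X in _ == X]surjective_pairing.
  by rewrite xpair_eqE !expg_porbit -e andbb.
by apply/eqP; rewrite eqn_dvd dE dvdnn -dE dvdnn.
Qed.

(** Testing the tail is enough: in an invariant forest the head lies on a cycle of the same length,
    by [inv_forest_ends]. *)
Definition arcs_over (D : seq nat) : {set pvb_index n} :=
  [set p | clen (val p).1 \in D].

Definition inv_char (D : seq nat) : {poly rat} :=
  \sum_(X | inv_forest X && (X \subset arcs_over D)) act_sign s X *: 'X^#|X|.

Lemma inv_char_nil : inv_char [::] = 1.
Proof.
rewrite /inv_char (big_pred1 set0) => [|X /=].
  by rewrite act_sign0 scale1r cards0 expr0.
have -> : arcs_over [::] = set0 by apply/setP=> p; rewrite !inE.
rewrite subset0 andb_idl // => /eqP ->.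
by rewrite /inv_forest imset0 eqxx chain_forest0.
Qed.

Lemma arcs_over_inv D p : (g p \in arcs_over D) = (p \in arcs_over D).
Proof. by rewrite !inE /= card_porbit_act. Qed.

Lemma inv_forestI X D : inv_forest X -> inv_forest (X :&: arcs_over D).
Proof.
case/andP=> chX /act_invP gX; rewrite /inv_forest (chain_forest_sub (subsetIl _ _) chX).
by apply/act_invP=> p; rewrite !in_setI gX arcs_over_inv.
Qed.

(** The arcs of X and those of Y touch disjoint sets of vertices, so they cannot collide, and the
    two ranks are glued according to cycle length. *)
Lemma inv_forestU X Y k D : k \notin D ->
  inv_forest X -> X \subset arcs_over [:: k] ->
  inv_forest Y -> Y \subset arcs_over D -> inv_forest (X :|: Y).
Proof.
move=> kD iX /subsetP Xk iY /subsetP YD; rewrite /inv_forest imsetU.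
rewrite !inv_forest_act // eqxx andbT.
have X1 p : p \in X -> clen (val p).1 = k by move/Xk; rewrite !inE => /eqP.
have X2 p : p \in X -> clen (val p).2 = k.
  by move=> Xp; rewrite -(inv_forest_ends iX) ?X1.
have Y1 p : p \in Y -> clen (val p).1 \in D by move/YD; rewrite inE.
have Y2 p : p \in Y -> clen (val p).2 \in D.
  by move=> Yp; rewrite -(inv_forest_ends iY) ?Y1.
case/and3P: (inv_forest_chain iX) => /out_injP oX /in_injP inX /acyclic_rank_ex[rX rXP].
case/and3P: (inv_forest_chain iY) => /out_injP oY /in_injP inY /acyclic_rank_ex[rY rYP].
apply/and3P; split.
- apply/out_injP=> p q; rewrite !in_setU => /orP[Xp|Yp] /orP[Xq|Yq] pq.
  + exact: oX.
  + by move: kD; rewrite -(X1 p Xp) pq Y1.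
  + by move: kD; rewrite -(X1 q Xq) -pq Y1.
  + exact: oY.
- apply/in_injP=> p q; rewrite !in_setU => /orP[Xp|Yp] /orP[Xq|Yq] pq.
  + exact: inX.
  + by move: kD; rewrite -(X2 p Xp) pq Y2.
  + by move: kD; rewrite -(X2 q Xq) -pq Y2.
  + exact: inY.
apply: (@acyclic_rank _ _ (fun i => if clen i == k then rX i else rY i)) => i j.
case/arcP=> p; rewrite in_setU => /orP[Xp|Yp] pE.
  have := X1 p Xp; have := X2 p Xp; rewrite pE /= => -> ->; rewrite eqxx.
  by apply: rXP; rewrite (memP_arc _ pE).
have := Y1 p Yp; have := Y2 p Yp; rewrite pE /= => Dj Di.
rewrite (negPf (memPn kD _ Di)) (negPf (memPn kD _ Dj)).
by apply: rYP; rewrite (memP_arc _ pE).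
Qed.

(** An invariant forest is the disjoint union of its parts over k and over D; these are again
    invariant forests, and sign and degree split accordingly. *)
Lemma inv_char_cons k D : k \notin D ->
  inv_char (k :: D) = inv_char [:: k] * inv_char D.
Proof.
move=> kD; rewrite {2 3}/inv_char big_distrlr pair_big /=.
have dis : [disjoint arcs_over [:: k] & arcs_over D].
  rewrite -setI_eq0; apply/eqP/setP=> p; rewrite !inE.
  by apply/negP=> /andP[/eqP->]; apply/negP.
have uni : arcs_over (k :: D) = arcs_over [:: k] :|: arcs_over D.
  by apply/setP=> p; rewrite !inE.
have rec X Y : X \subset arcs_over [:: k] -> Y \subset arcs_over D ->
    (X :|: Y) :&: arcs_over [:: k] = X /\ (X :|: Y) :&: arcs_over D = Y.
  move=> Xk YD; rewrite !setIUl (setIidPl Xk) (setIidPl YD).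
  have /eqP-> : Y :&: arcs_over [:: k] == set0.
    by rewrite setI_eq0 disjoint_sym (disjointWr YD).
  have /eqP-> : X :&: arcs_over D == set0 by rewrite setI_eq0 (disjointWl Xk).
  by rewrite setU0 set0U.
rewrite /inv_char (reindex_onto
  (fun u : {set pvb_index n} * {set pvb_index n} => u.1 :|: u.2)
  (fun X => (X :&: arcs_over [:: k], X :&: arcs_over D))) /=; last first.
  by move=> X /andP[_ Xkd]; rewrite -setIUr -uni; apply/setIidPl.
apply: eq_big => [[X Y]|[X Y]] /=.
  rewrite xpair_eqE; apply/idP/idP.
    case/andP=> /andP[iU sU] /andP[/eqP eX /eqP eY].
    have [iX Xk] : inv_forest X /\ X \subset arcs_over [:: k].
      by rewrite -eX inv_forestI ?subsetIr.
    have [iY YD] : inv_forest Y /\ Y \subset arcs_over D.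
      by rewrite -eY inv_forestI ?subsetIr.
    by rewrite iX Xk iY YD.
  case/andP=> /andP[iX Xk] /andP[iY YD].
  rewrite (inv_forestU kD iX Xk iY YD) uni setUSS //=.
  by have [-> ->] := rec X Y Xk YD; rewrite !eqxx.
case/andP=> /andP[iU sU]; rewrite xpair_eqE => /andP[/eqP eX /eqP eY].
have dXY : [disjoint X & Y].
  by rewrite -eX -eY (disjointWl (subsetIr _ _)) // (disjointWr (subsetIr _ _)).
rewrite act_signU //; last first.
- by rewrite -eY; apply/inv_forest_act/inv_forestI.
- by rewrite -eX; apply/inv_forest_act/inv_forestI.
rewrite cardsU (eqP (_ : X :&: Y == set0)) ?setI_eq0 // cards0 subn0 exprD.
by rewrite -scalerAl -scalerAr scalerA.
Qed.

Lemma inv_char_prod D : uniq D -> inv_char D = \prod_(k <- D) inv_char [:: k].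
Proof.
elim: D => [|k D IH] /=; first by rewrite inv_char_nil big_nil.
by case/andP=> kD uD; rewrite inv_char_cons // IH // big_cons.
Qed.

Lemma pvb_char_inv D : (forall i, clen i \in D) -> pvb_char s = inv_char D.
Proof.
move=> DT; rewrite pvb_char_forests; apply: eq_bigl => X.
have -> : arcs_over D = setT by apply/setP=> p; rewrite !inE DT.
by rewrite subsetT andbT.
Qed.

End Factorization.

(** * Permutations with cycles of equal length *)

Section HomogeneousPart.

Variables (n : nat) (s : 'S_n) (k : nat).
Hypothesis k0 : (0 < k)%N.
Implicit Types (u v : 'I_n) (p q : pvb_index n) (X Y : {set pvb_index n}).

Local Notation g := (pvb_index_act s).
Local Notation clen i := #|porbit s i|.

Lemma act_inv_sub X : {in X, forall p, g p \in X} -> g @: X = X.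
Proof.
move=> gX; apply/eqP; rewrite eqEcard card_imset ?leqnn ?andbT.
  by apply/subsetP=> _ /imsetP[p Xp ->]; apply: gX.
exact: pvb_index_act_inj.
Qed.

Lemma connect_homo (T : finType) (e : rel T) (f : T -> T) x y :
  (forall a b, e a b -> e (f a) (f b)) -> connect e x y -> connect e (f x) (f y).
Proof.
move=> fe /connectP[t + ->]; elim: t x => [|z t IH] x /=; first by rewrite connect0.
by case/andP=> /fe exz /IH; apply: connect_trans; apply: connect1.
Qed.

Lemma inv_forest_arc X u v m : inv_forest s X ->
  arc X u v -> arc X ((s ^+ m)%g u) ((s ^+ m)%g v).
Proof.
move=> iX /arcP[p Xp pE]; apply/arcP; exists ((arc_perm s ^+ m)%g p).
  by rewrite act_inv_expg ?inv_forest_act.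
by rewrite val_arc_permX pE.
Qed.

(** Powers of s map paths of X to paths of X, so the number of ancestors is constant on cycles of s.
    The rank thus descends to the cycles: no arc joins two points of one cycle, and the projected
    forest is acyclic. *)
Lemma inv_forest_rank X : inv_forest s X -> exists rk : 'I_n -> nat,
  (forall u v, arc X u v -> (rk u < rk v)%N) /\
  (forall u v, u \in porbit s v -> rk u = rk v).
Proof.
move=> iX; have /and3P[_ _ acX] := inv_forest_chain iX.
exists (fun u => #|[set l | connect (arc X) l u]|); split=> [u v auv|].
  exact: card_ancestors_arc.
have le u v : u \in porbit s v ->
    (#|[set l | connect (arc X) l v]| <= #|[set l | connect (arc X) l u]|)%N.
  case/porbitP=> m ->; rewrite -(card_imset _ (@perm_inj _ (s ^+ m)%g)).
  apply/subset_leq_card/subsetP=> _ /imsetP[l + ->]; rewrite !inE.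
  by apply: connect_homo => a b; apply: inv_forest_arc.
by move=> u v uv; apply/eqP; rewrite eqn_leq !le // porbit_sym.
Qed.

(** With the hypotheses below, [b] picks one base point on each cycle of length k, so the elements
    of ['I_a] stand for these cycles. *)
Variables (a : nat) (b : 'I_a -> 'I_n).
Hypothesis b_len : forall i, clen (b i) = k.
Hypothesis b_inj : forall i j, b i \in porbit s (b j) -> i = j.
Hypothesis b_surj : forall u, clen u = k -> exists i, u \in porbit s (b i).
Implicit Types (i j : 'I_a) (e : pvb_index a) (S : {set pvb_index a}).

Lemma over_uniq u i j : u \in porbit s (b i) -> u \in porbit s (b j) -> i = j.
Proof.
by rewrite -!eq_porbit_mem => /eqP ui /eqP uj; apply: b_inj; rewrite -eq_porbit_mem -ui uj.
Qed.

Definition forest_proj X : {set pvb_index a} :=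
  [set e | [exists p in X, ((val p).1 \in porbit s (b (val e).1)) &&
                           ((val p).2 \in porbit s (b (val e).2))]].

Definition k_forest X := inv_forest s X && (X \subset arcs_over s [:: k]).

Lemma forest_projP X e :
  reflect (exists2 p, p \in X & (val p).1 \in porbit s (b (val e).1) /\
                                (val p).2 \in porbit s (b (val e).2))
          (e \in forest_proj X).
Proof. by rewrite inE; apply: (iffP exists_inP) => -[p Xp /andP]; exists p. Qed.

Lemma k_forest_proj_ex X p : k_forest X -> p \in X ->
  exists2 e, e \in forest_proj X & (val p).1 \in porbit s (b (val e).1) /\
                                   (val p).2 \in porbit s (b (val e).2).
Proof.
case/andP=> iX /subsetP Xk Xp; have := Xk p Xp; rewrite !inE => /eqP l1.
have l2 : clen (val p).2 = k by rewrite -(inv_forest_ends iX Xp).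
have [i pi] := b_surj l1; have [j pj] := b_surj l2.
have [rk [rkX rks]] := inv_forest_rank iX.
have nij : i != j.
  apply/eqP=> eij; have := rkX _ _ (arc_mem Xp).
  by rewrite (rks _ _ pi) (rks _ _ pj) eij ltnn.
have [e eE] := pvb_index_ex nij; exists e; last by rewrite eE.
by apply/forest_projP; exists p => //; rewrite eE.
Qed.

(** If two arcs leave the same cycle, a power of s matches their tails, hence the arcs themselves,
    so their heads share a cycle; likewise for arcs entering the same cycle. *)
Lemma k_forest_proj X : k_forest X -> chain_forest (forest_proj X).
Proof.
case/andP=> iX _; have [rk [rkX rks]] := inv_forest_rank iX.
have /and3P[/out_injP oX /in_injP inX _] := inv_forest_chain iX.
have gX := inv_forest_act iX.
have tr u v i : u \in porbit s v -> v \in porbit s (b i) -> u \in porbit s (b i).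
  by rewrite -!eq_porbit_mem => /eqP ->.
apply/and3P; split.
- apply/out_injP=> e e' /forest_projP[p Xp [p1 p2]] /forest_projP[p' Xp' [p1' p2']] ee'.
  have /porbitP[m mE] : (val p').1 \in porbit s (val p).1.
    by move: p1 p1'; rewrite ee' -!eq_porbit_mem => /eqP-> /eqP->.
  have p'E : p' = (arc_perm s ^+ m)%g p.
    by apply: oX; rewrite ?act_inv_expg // val_arc_permX.
  apply: val_inj; rewrite [LHS]surjective_pairing [RHS]surjective_pairing ee'.
  congr (_, _); apply: over_uniq p2'; apply: tr p2.
  by rewrite p'E val_arc_permX mem_porbit.
- apply/in_injP=> e e' /forest_projP[p Xp [p1 p2]] /forest_projP[p' Xp' [p1' p2']] ee'.
  have /porbitP[m mE] : (val p').2 \in porbit s (val p).2.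
    by move: p2 p2'; rewrite ee' -!eq_porbit_mem => /eqP-> /eqP->.
  have p'E : p' = (arc_perm s ^+ m)%g p.
    by apply: inX; rewrite ?act_inv_expg // val_arc_permX.
  apply: val_inj; rewrite [LHS]surjective_pairing [RHS]surjective_pairing ee'.
  congr (_, _); apply: over_uniq p1'; apply: tr p1.
  by rewrite p'E val_arc_permX mem_porbit.
apply: (@acyclic_rank _ _ (fun i => rk (b i))) => i j /arcP[e].
case/forest_projP=> p Xp [p1 p2] eE; move: p1 p2; rewrite eE => /rks <- /rks <-.
exact/rkX/arc_mem.
Qed.

(** * Lifts of a chain forest on the cycles *)

Section Fiber.

Variable S : {set pvb_index a}.
Hypothesis chS : chain_forest S.

(* The lifts of S are encoded by the heads y e of the lifted arcs that leave the
   base points b (val e).1; y is constrained to a single value off S, so that a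
   lift has only one code. *)
Definition lift_family e : pred 'I_n :=
  if e \in S then [in porbit s (b (val e).2)] else pred1 (b (val e).2).

Lemma lift_familyE e v : e \in S -> (v \in lift_family e) = (v \in porbit s (b (val e).2)).
Proof. by rewrite /lift_family => ->. Qed.

(** The quantification over q is there because a pair is an arc only if its ends differ, which
    [lift_family_neq] provides for a code y. *)
Definition forest_lift (y : {ffun pvb_index a -> 'I_n}) : {set pvb_index n} :=
  [set p | [exists e in S, [exists q, (val q == (b (val e).1, y e)) &&
                                      (p \in porbit (arc_perm s) q)]]].

Lemma lift_familyP y e : y \in family lift_family -> y e \in porbit s (b (val e).2).
Proof.
move/familyP/(_ e); rewrite /lift_family; case: ifP => // _.
by rewrite inE => /eqP ->; apply: porbit_id.
Qed.

Lemma lift_family_neq y e : y \in family lift_family -> b (val e).1 != y e.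
Proof.
move=> yF; apply: contraTneq (valP e) => by_; rewrite negbK; apply/eqP/b_inj.
by rewrite by_ lift_familyP.
Qed.

Lemma forest_liftP y p : y \in family lift_family ->
  reflect (exists2 e, e \in S &
             exists m, val p = ((s ^+ m)%g (b (val e).1), (s ^+ m)%g (y e)))
          (p \in forest_lift y).
Proof.
move=> yF; rewrite inE; apply: (iffP exists_inP) => [[e Se]|[e Se [m pE]]].
  case/existsP=> q /andP[/eqP qE /porbitP[m ->]].
  by exists e => //; exists m; rewrite val_arc_permX qE.
exists e => //; have [q qE] := pvb_index_ex (lift_family_neq e yF);
apply/existsP; exists q; rewrite qE eqxx /=.
apply/porbitP; exists m; apply: val_inj.
by rewrite [RHS]val_arc_permX qE.
Qed.

Lemma mem_lift y e m q : y \in family lift_family -> e \in S ->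
  val q = ((s ^+ m)%g (b (val e).1), (s ^+ m)%g (y e)) -> q \in forest_lift y.
Proof. by move=> yF Se qE; apply/forest_liftP => //; exists e => //; exists m. Qed.

Lemma lift_arc_ex y e : y \in family lift_family -> e \in S ->
  exists2 q, q \in forest_lift y & val q = (b (val e).1, y e).
Proof.
move=> yF Se; have [q qE] := pvb_index_ex (lift_family_neq e yF); exists q => //.
by apply: (@mem_lift y e 0) => //; rewrite expg0 !perm1.
Qed.

Lemma lift_len y e : y \in family lift_family -> clen (b (val e).1) = clen (y e).
Proof.
move=> yF; have := lift_familyP e yF; rewrite -eq_porbit_mem => /eqP ->.
by rewrite !b_len.
Qed.

(** Arcs over different e have their tails on different cycles, and their heads too. Translates of
    one arc that share an end coincide, both ends having the same period. *)
Lemma forest_lift_k_forest y : y \in family lift_family -> k_forest (forest_lift y).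
Proof.
move=> yF; case/and3P: chS => /out_injP oS /in_injP inS /acyclic_rank_ex[rk rkS].
apply/andP; split; last first.
  apply/subsetP=> p /(forest_liftP _ yF)[e Se [m pE]].
  by rewrite !inE pE /= porbit_perm b_len.
apply/andP; split; last first.
  apply/eqP/act_inv_sub => p /(forest_liftP _ yF)[e Se [m pE]].
  apply/(forest_liftP _ yF); exists e => //; exists m.+1.
  by rewrite /= pE !expgSr !permM.
apply/and3P; split.
- apply/out_injP=> p p' /(forest_liftP _ yF)[e Se [m pE]] /(forest_liftP _ yF)[e' Se' [m' pE']].
  rewrite pE pE' /= => mm.
  have ee : e = e'.
    apply: oS => //; apply: (@over_uniq ((s ^+ m)%g (b (val e).1))).
      exact: mem_porbit.
    by rewrite mm mem_porbit.
  subst e'; apply: val_inj; rewrite pE pE' mm; congr (_, _).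
  exact: expg_porbit_eq (lift_len e yF) mm.
- apply/in_injP=> p p' /(forest_liftP _ yF)[e Se [m pE]] /(forest_liftP _ yF)[e' Se' [m' pE']].
  rewrite pE pE' /= => mm.
  have tr u v i : u \in porbit s v -> v \in porbit s (b i) -> u \in porbit s (b i).
    by rewrite -!eq_porbit_mem => /eqP ->.
  have ee : e = e'.
    apply: inS => //; apply: (@over_uniq ((s ^+ m)%g (y e))).
      exact: tr (mem_porbit _ _ _) (lift_familyP e yF).
    by rewrite mm; apply: tr (mem_porbit _ _ _) (lift_familyP e' yF).
  subst e'; apply: val_inj; rewrite pE pE' mm; congr (_, _).
  exact: expg_porbit_eq (esym (lift_len e yF)) mm.
(* The index of the cycle through u. The default rank 0 below is for vertices on cycles of other
   lengths, which no lifted arc meets. *)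
pose o u := [pick i | u \in porbit s (b i)].
have oE u i : u \in porbit s (b i) -> o u = Some i.
  rewrite /o => ui; case: pickP => [j uj|/(_ i)]; last by rewrite ui.
  by rewrite (over_uniq ui uj).
apply: (@acyclic_rank _ _ (fun u => if o u is Some i then rk i else 0%N)) => u v.
case/arcP=> p /(forest_liftP _ yF)[e Se [m ->]] [<- <-].
rewrite (oE _ (val e).1) ?mem_porbit // (oE _ (val e).2).
  exact/rkS/arc_mem.
rewrite -eq_porbit_mem porbit_perm eq_porbit_mem; exact: lift_familyP.
Qed.

Lemma forest_lift_proj y : y \in family lift_family -> forest_proj (forest_lift y) = S.
Proof.
move=> yF; apply/setP=> e; apply/forest_projP/idP => [[p]|Se].
  case/(forest_liftP _ yF)=> e' Se' [m ->] /= [p1 p2].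
  suff -> : e = e' by [].
  have e1 : (val e).1 = (val e').1 by apply: over_uniq p1 (mem_porbit _ _ _).
  have e2 : (val e).2 = (val e').2.
    apply: over_uniq p2 _.
    by rewrite -eq_porbit_mem porbit_perm eq_porbit_mem lift_familyP.
  by apply: val_inj; rewrite [LHS]surjective_pairing [RHS]surjective_pairing e1 e2.
have [q Xq qE] := lift_arc_ex yF Se; exists q => //.
by rewrite qE /= porbit_id lift_familyP.
Qed.

(** The code is read off the arc leaving each base point: a power of s that fixes the base point
    also fixes the coded head, whose cycle has the same length. *)
Lemma forest_lift_inj : {in family lift_family &, injective forest_lift}.
Proof.
case/and3P: chS => /out_injP oS _ _.
move=> y y' yF yF' eqL; apply/ffunP=> e; have [Se|nSe] := boolP (e \in S); last first.
  move/familyP/(_ e): yF; move/familyP/(_ e): yF'.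
  by rewrite /lift_family (negPf nSe) !inE => /eqP-> /eqP->.
have [q Xq qE] := lift_arc_ex yF Se; move: Xq; rewrite eqL.
case/(forest_liftP _ yF')=> e' Se' [m]; rewrite qE => -[be ye].
have ee : e = e'.
  apply: oS => //; apply: (@over_uniq (b (val e).1)); first exact: porbit_id.
  by rewrite be mem_porbit.
subst e'; rewrite ye.
have := @expg_porbit_eq _ s _ _ m 0 (lift_len e yF').
by rewrite !expg0 !perm1; apply.
Qed.

(** For each e in S, an arc of X over e is translated until its tail is the base point; its head is
    then the code. Since tails determine arcs, every arc of X is a translate of one of these. *)
Lemma forest_lift_surj X : k_forest X -> forest_proj X = S ->
  exists2 y, y \in family lift_family & X = forest_lift y.
Proof.
move=> kX projX; have /andP[iX _] := kX.
have /and3P[/out_injP oX _ _] := inv_forest_chain iX.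
have gX := inv_forest_act iX.
have ex e : exists v, (v \in lift_family e) && ((e \in S) ==> arc X (b (val e).1) v).
  have [Se|nSe] := boolP (e \in S); last first.
    by exists (b (val e).2); rewrite /lift_family (negPf nSe) inE eqxx.
  have := Se; rewrite -projX => /forest_projP[p Xp [p1 p2]].
  move: p1; rewrite porbit_sym => /porbitP[m bE].
  exists ((s ^+ m)%g (val p).2); rewrite lift_familyE //=.
  rewrite -eq_porbit_mem porbit_perm eq_porbit_mem p2 /= bE.
  exact/inv_forest_arc/arc_mem.
have [f fP] := fin_all_exists ex.
have yF : [ffun e => f e] \in family lift_family.
  by apply/familyP=> e; rewrite ffunE; case/andP: (fP e).
have arcf e : e \in S -> arc X (b (val e).1) (f e).
  by move=> Se; case/andP: (fP e) => _ /implyP; apply.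
exists [ffun e => f e] => //; apply/setP=> p; apply/idP/idP => [Xp|].
  have [e] := k_forest_proj_ex kX Xp; rewrite projX => Se [p1 p2].
  have /arcP[q Xq qE] := arcf e Se; case/porbitP: p1 => m mE.
  have -> : p = (arc_perm s ^+ m)%g q.
    by apply: oX; rewrite ?act_inv_expg // val_arc_permX qE.
  by apply: (@mem_lift _ e m) => //; rewrite val_arc_permX qE ffunE.
case/(forest_liftP _ yF)=> e Se [m pE]; have /arcP[q Xq qE] := arcf e Se.
have -> : p = (arc_perm s ^+ m)%g q.
  by apply: val_inj; rewrite [RHS]val_arc_permX qE pE ffunE.
by rewrite act_inv_expg.
Qed.

Lemma card_fiber : #|[set X | k_forest X && (forest_proj X == S)]| = (k ^ #|S|)%N.
Proof.
have -> : [set X | k_forest X && (forest_proj X == S)] =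
    forest_lift @: [set y in family lift_family].
  apply/setP=> X; rewrite inE; apply/andP/imsetP => [[kX /eqP/(forest_lift_surj kX)[y yF ->]]|].
    by exists y; rewrite ?inE.
  by case=> y; rewrite inE => yF ->; rewrite forest_lift_k_forest ?forest_lift_proj.
rewrite card_in_imset => [|y y']; last by rewrite !inE; apply: forest_lift_inj.
rewrite cardsE card_family foldrE big_image /= (bigID [in S]) /=.
rewrite [X in (_ * X)%N]big1 ?muln1 => [|e nSe]; last first.
  by rewrite /lift_family (negPf nSe) card1.
rewrite (eq_bigr (fun=> k)) ?prod_nat_const // => e Se.
by rewrite -(b_len (val e).2); apply: eq_card => v; apply: lift_familyE.
Qed.

(** Count tails: they are distinct for distinct arcs of X and fill exactly the cycles that are
    sources in S, each with k points. *)
Lemma card_k_forest X : k_forest X -> forest_proj X = S -> #|X| = (k * #|S|)%N.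
Proof.
move=> kX projX; have /andP[iX _] := kX.
have /and3P[/out_injP oX _ _] := inv_forest_chain iX.
have gX := inv_forest_act iX.
case/and3P: chS => /out_injP oS _ _.
rewrite -(card_in_imset oX).
have -> : [set (val p).1 | p in X] =
    \bigcup_e (if e \in S then porbit s (b (val e).1) else set0).
  apply/setP=> u; apply/imsetP/bigcupP => [[p Xp ->]|[e _]].
    have [e] := k_forest_proj_ex kX Xp; rewrite projX => Se [p1 _].
    by exists e; rewrite ?Se.
  case: ifP; last by rewrite inE.
  rewrite -projX => /forest_projP[p Xp [p1 _]] ue.
  have /porbitP[m ->] : u \in porbit s (val p).1.
    by move: p1 ue; rewrite -!eq_porbit_mem => /eqP-> /eqP->.
  by exists ((arc_perm s ^+ m)%g p); rewrite ?act_inv_expg // val_arc_permX.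
rewrite -sum1_card partition_disjoint_bigcup => [|e e' nee]; last first.
  case: ifP => Se; case: ifP => Se'; rewrite -setI_eq0 ?set0I ?setI0 //.
  apply/eqP/setP=> u; rewrite !inE; apply/negP=> /andP[ue ue'].
  by case/eqP: nee; apply: oS => //; apply: over_uniq ue ue'.
rewrite (bigID [in S]) /= [X in (_ + X)%N]big1 ?addn0 => [|e /negPf->]; last by rewrite big_set0.
rewrite (eq_bigr (fun=> k)) => [|e ->]; last by rewrite sum1_card b_len.
by rewrite sum_nat_const mulnC.
Qed.

End Fiber.

Lemma k_forest_act_sign X : k_forest X ->
  act_sign s X = (-1) ^+ (k.-1 * #|forest_proj X|).
Proof.
move=> kX; have /andP[iX /subsetP Xk] := kX.
have Xlen : {in X, forall p, #|porbit (arc_perm s) p| = k}.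
  move=> p Xp; rewrite (card_arc_porbit (inv_forest_ends iX Xp)).
  by have := Xk p Xp; rewrite !inE => /eqP.
have [d [dE ->]] := act_sign_homogeneous (inv_forest_act iX) Xlen.
(* Both d and the size of the projection give the size of X when multiplied by k. *)
congr (_ ^+ (_ * _)); apply/eqP; rewrite -(eqn_pmul2l k0) -dE.
by rewrite (card_k_forest (k_forest_proj kX) kX erefl).
Qed.

Lemma inv_char_homogeneous_base :
  inv_char s [:: k] = pvb_hilbert a \Po (((-1) ^+ k.-1 * k%:R) *: 'X^k).
Proof.
rewrite pvb_hilbert_forests linear_sum /= /inv_char.
rewrite (partition_big forest_proj (@chain_forest a)) /=; last exact: k_forest_proj.
apply: eq_bigr => S chS; rewrite comp_Xn_poly exprZn -exprM.
have -> : ((-1) ^+ k.-1 * k%:R) ^+ #|S| *: 'X^(k * #|S|) =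
    \sum_(X | k_forest X && (forest_proj X == S))
       (-1) ^+ (k.-1 * #|S|) *: 'X^(k * #|S|) :> {poly rat}.
  have := card_fiber chS; rewrite cardsE => cF.
  rewrite sumr_const cF -scaler_nat scalerA exprMn -exprM natrX.
  by rewrite [X in X *: _]mulrC.
apply: eq_bigr => X /andP[kX /eqP projX].
by rewrite k_forest_act_sign // projX (card_k_forest chS kX projX).
Qed.

End HomogeneousPart.

Lemma inv_char_homogeneous n (s : 'S_n) k : (0 < k)%N ->
  inv_char s [:: k] =
  pvb_hilbert (count_mem k (cycle_lengths s)) \Po (((-1) ^+ k.-1 * k%:R) *: 'X^k).
Proof.
move=> k0; pose P := [set C in porbits s | #|C| == k].
have -> : count_mem k (cycle_lengths s) = #|P|.
  rewrite count_map -sum1_count big_enum_cond -sum1_card.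
  by apply: eq_bigl => C; rewrite [RHS]inE.
have ex (i : 'I_#|P|) : exists u, porbit s u = enum_val i.
  have := enum_valP i; rewrite inE => /andP[/imsetP[u _ ->] _].
  by exists u.
have [b bE] := fin_all_exists ex.
apply: (@inv_char_homogeneous_base _ _ _ k0 _ b) => [i|i j|u uk].
- by rewrite bE; have := enum_valP i; rewrite inE => /andP[_ /eqP].
- by rewrite -eq_porbit_mem !bE => /eqP/enum_val_inj.
have Pu : porbit s u \in P by rewrite inE uk eqxx andbT; apply: imset_f.
exists (enum_rank_in Pu (porbit s u)).
by rewrite -eq_porbit_mem bE enum_rankK_in.
Qed.

(** * Chain forests and Lah numbers *)

Section Consecutive.

Variable T : eqType.
Implicit Types (x y : T) (s t u v : seq T) (L : seq (seq T)).

Definition consec s : seq (T * T) := zip s (behead s).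

Lemma consec_cons2 x y s : consec [:: x, y & s] = (x, y) :: consec (y :: s).
Proof. by []. Qed.

Lemma consecP x y s :
  reflect (exists u v, s = u ++ [:: x, y & v]) ((x, y) \in consec s).
Proof.
apply: (iffP idP) => [|[u [v ->]]].
  elim: s => // z [|w s] // IH; rewrite consec_cons2 inE.
  case/predU1P=> [[-> ->]|/IH[u [v E]]]; first by exists [::], s.
  by exists (z :: u), v; rewrite /= -E.
elim: u => [|z [|w u] IH]; rewrite ?mem_head //=; first by rewrite inE mem_head orbT.
by rewrite consec_cons2 inE IH orbT.
Qed.

Lemma consec_cat u x y v :
  consec (u ++ [:: x, y & v]) = consec (rcons u x) ++ (x, y) :: consec (y :: v).
Proof. by elim: u => // z [|w u] // IH; rewrite /= consec_cons2 IH. Qed.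

Lemma sorted_consec (e : rel T) s :
  sorted e s = all (fun a => e a.1 a.2) (consec s).
Proof. by elim: s => // x [|y s] //= IH; rewrite /= in IH *; rewrite IH. Qed.

(** This makes the consecutive pairs of a duplicate-free list distinct, already by their first
    components. *)
Lemma subseq_consec s : subseq (map fst (consec s)) s.
Proof.
rewrite /consec -/(unzip1 _); case: s => // x s.
by elim: s x => // y s IH x; rewrite /= eqxx; apply: IH.
Qed.

Lemma flatten_uniq_mem L s t x : uniq (flatten L) ->
  s \in L -> t \in L -> x \in s -> x \in t -> s = t.
Proof.
elim: L => // r L IH; rewrite /= cat_uniq !inE => /and3P[_ /hasPn dis uL].
have no w : w \in L -> x \in w -> x \in r -> False.
  by move=> Lw wx rx; have /dis/negP : x \in flatten L by apply/flattenP; exists w.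
case/predU1P=> [->|Ls] /predU1P[->|Lt] //; last exact: IH.
- by move=> rx tx; case: (no t).
- by move=> sx rx; case: (no s).
Qed.

(** A nonempty list has one consecutive pair fewer than entries; an empty one would break the
    count. *)
Lemma size_flatten_consec L : [::] \notin L ->
  (size (flatten (map consec L)) + size L = size (flatten L))%N.
Proof.
elim: L => // s L IH; rewrite inE negb_or => /andP[s0 /IH {}IH] /=.
rewrite !size_cat -IH; case: s s0 => // x s _.
by rewrite /consec size_zip /= (minn_idPr (leqnSn _)) addnS addSn addnA.
Qed.

End Consecutive.

Section Lah.

Variable m : nat.
Implicit Types (x y i j : 'I_m) (p q : pvb_index m) (S : {set pvb_index m}).
Implicit Types (s t : seq 'I_m) (L : seq (seq 'I_m)).

Definition list_partition L :=
  perm_eq (flatten L) (enum 'I_m) && ([::] \notin L).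

Definition list_arcs L : {set pvb_index m} :=
  [set p | val p \in flatten (map (@consec _) L)].

Lemma arc_list L i j : i != j ->
  arc (list_arcs L) i j = ((i, j) \in flatten (map (@consec _) L)).
Proof.
by case/pvb_index_ex=> p pE; rewrite (memP_arc _ pE) inE pE.
Qed.

Section OfPartition.

Variable L : seq (seq 'I_m).
Hypothesis partL : list_partition L.

Lemma list_partition_uniq : uniq (flatten L).
Proof. by case/andP: partL => /perm_uniq-> _; apply: enum_uniq. Qed.

Lemma list_partition_mem x : x \in flatten L.
Proof. by case/andP: partL => /perm_mem-> _; rewrite mem_enum. Qed.

Lemma list_partition_ex x : exists2 s, s \in L & x \in s.
Proof. by apply/flattenP/list_partition_mem. Qed.

Lemma list_arcs_ex i j : arc (list_arcs L) i j ->
  exists2 s, s \in L & (i, j) \in consec s.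
Proof.
by move=> aij; move: (aij); rewrite arc_list ?(arc_neq aij) // => /flatten_mapP.
Qed.

Lemma list_partition_cat s : s \in L ->
  exists u v, flatten L = u ++ s ++ v.
Proof.
by case/splitPr=> L1 L2; rewrite flatten_cat /=; exists (flatten L1), (flatten L2).
Qed.

Lemma list_uniq s : s \in L -> uniq s.
Proof.
case/list_partition_cat=> u [v E]; have := list_partition_uniq.
by rewrite E !cat_uniq => /and3P[_ _ /and3P[]].
Qed.

Lemma list_consec_arc s i j : s \in L -> (i, j) \in consec s -> arc (list_arcs L) i j.
Proof.
move=> Ls cij; rewrite arc_list; first by apply/flatten_mapP; exists s.
have /consecP[u [v sE]] := cij; have := list_uniq Ls; rewrite sE cat_uniq.
by case/and3P=> _ _ /= /andP[]; rewrite inE negb_or => /andP[].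
Qed.

(** Positions in the concatenation rise by exactly 1 along arcs, which gives both injectivity
    conditions and acyclicity at once. *)
Lemma list_arcs_index i j : arc (list_arcs L) i j ->
  index j (flatten L) = (index i (flatten L)).+1.
Proof.
case/list_arcs_ex=> s Ls /consecP[u [v sE]].
have [u' [v' E]] := list_partition_cat Ls; have := list_partition_uniq.
have -> : flatten L = (u' ++ u) ++ [:: i, j & v ++ v'] by rewrite E sE -!catA.
rewrite cat_uniq !index_cat => /and3P[_ /hasPn dis /= /and3P[]].
rewrite inE negb_or => /andP[nij _] _ _.
have /negPf-> := dis i (mem_head _ _).
have /negPf-> : j \notin u' ++ u by apply: dis; rewrite !inE eqxx orbT.
by rewrite eqxx (negPf nij) eqxx addn0 addn1.
Qed.

Lemma list_arcs_chain_forest : chain_forest (list_arcs L).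
Proof.
have idx p : p \in list_arcs L ->
    index (val p).2 (flatten L) = (index (val p).1 (flatten L)).+1.
  by move/arc_mem/list_arcs_index.
have idx_inj x y : index x (flatten L) = index y (flatten L) -> x = y.
  move=> e; rewrite -(nth_index x (list_partition_mem x)) e.
  by rewrite nth_index ?list_partition_mem.
apply/and3P; split.
- apply/out_injP=> p q Lp Lq pq; apply: val_inj.
  rewrite [LHS]surjective_pairing [RHS]surjective_pairing pq; congr (_, _).
  by apply: idx_inj; rewrite !idx // pq.
- apply/in_injP=> p q Lp Lq pq; apply: val_inj.
  rewrite [LHS]surjective_pairing [RHS]surjective_pairing pq; congr (_, _).
  by apply: idx_inj; apply: succn_inj; rewrite -!idx // pq.
apply: (@acyclic_rank _ _ (fun i => index i (flatten L))) => i j.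
by move/list_arcs_index->.
Qed.

Lemma card_list_arcs : (#|list_arcs L| + size L = m)%N.
Proof.
have [/perm_size sL nL] := andP partL.
rewrite -[RHS]size_enum_ord -sL -size_flatten_consec //; congr (_ + _)%N.
have u : uniq (flatten [seq consec s | s <- L]).
  apply: (@map_uniq _ _ fst); apply: subseq_uniq list_partition_uniq.
  rewrite map_flatten -map_comp; elim: (L) => //= s L' IH.
  by rewrite cat_subseq // subseq_consec.
rewrite -(card_uniqP u) -(card_imset _ val_inj); apply: eq_card => -[i j].
apply/imsetP/idP => [[p]|cij]; first by rewrite inE => ? ->.
have /flatten_mapP[s Ls sij] := cij.
by have /arcP[p Lp pE] := list_consec_arc Ls sij; exists p.
Qed.

Local Notation R := (connect (arc (list_arcs L))).

Lemma list_sorted s : s \in L -> sorted R s.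
Proof.
move=> Ls; rewrite sorted_consec; apply/allP=> -[i j] /= /(list_consec_arc Ls).
exact: connect1.
Qed.

(** No arc leaves a list, and a list is sorted for reachability, so any two of its entries are
    comparable. *)
Lemma list_memE s x y : s \in L -> x \in s -> (y \in s) = R x y || R y x.
Proof.
have arc_s s' i j : s' \in L -> arc (list_arcs L) i j -> (i \in s') = (j \in s').
  move=> Ls' /list_arcs_ex[t Lt /consecP[u [v tE]]].
  have ti : i \in t by rewrite tE mem_cat mem_head orbT.
  have tj : j \in t by rewrite tE mem_cat !inE eqxx !orbT.
  by apply/idP/idP=> [si|sj]; [rewrite (flatten_uniq_mem list_partition_uniq Ls' Lt si ti)
    |rewrite (flatten_uniq_mem list_partition_uniq Ls' Lt sj tj)].
have con_s s' i j : s' \in L -> R i j -> (i \in s') = (j \in s').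
  move=> Ls' /connectP[t + ->]; elim: t i => //= k t IH i /andP[aik pk].
  by rewrite (arc_s _ _ _ Ls' aik) (IH _ pk).
move=> Ls sx; apply/idP/orP => [sy|[]/(con_s _ _ _ Ls)]; last 2 first.
- by rewrite sx => <-.
- by rewrite sx.
have tr : transitive R by move=> a b c; apply: connect_trans.
have rf : reflexive R by move=> a; apply: connect0.
have H := sorted_leq_index tr rf (list_sorted Ls).
by case/orP: (leq_total (index x s) (index y s)) => le; [left|right]; apply: H.
Qed.

End OfPartition.

(** The list through x consists of the points comparable with x, sorted by reachability. The arcs do
    not see the order of the lists in L, so the conclusion is an inclusion. *)
Lemma list_arcs_inj L L' : list_partition L -> list_partition L' ->
  list_arcs L = list_arcs L' -> {subset L <= L'}.
Proof.
move=> pL pL' eL s Ls; have [_ nL] := andP pL.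
case: s Ls => [Ls|x s Ls]; first by case/negP: nL.
have [t L't tx] := list_partition_ex pL' x.
suff -> : x :: s = t by [].
have tr : transitive (connect (arc (list_arcs L))) by move=> a b c; apply: connect_trans.
have an : antisymmetric (connect (arc (list_arcs L))).
  move=> a b /andP[]; apply: acyclic_anti.
  by case/and3P: (list_arcs_chain_forest pL).
apply: (sorted_eq tr an); first exact: list_sorted.
  by rewrite eL; apply: list_sorted.
apply: uniq_perm => [||y]; [exact: list_uniq pL _ Ls | exact: list_uniq pL' _ L't|].
by rewrite (list_memE pL y Ls (mem_head _ _)) (list_memE pL' y L't tx) eL.
Qed.

(** Induction on the number of arcs. In a partition for S without i -> j, the point i ends its list
    and j begins its own, as any further arc there would collide with i -> j; joining the two lists
    adds exactly that arc. *)
Lemma list_arcs_surj S : chain_forest S -> exists2 L, list_partition L & list_arcs L = S.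
Proof.
have [d] := ubnP #|S|; elim: d S => // d IH S /ltnSE leSd chS.
have [->|[p Sp]] := set_0Vmem S.
  exists [seq [:: x] | x <- enum 'I_m].
    rewrite /list_partition flatten_map1 map_id perm_refl /=.
    by apply/mapP=> -[].
  apply/setP=> q; rewrite !inE; apply/flatten_mapP => -[_ /mapP[x _ ->]].
  by rewrite in_nil.
have chS' : chain_forest (S :\ p) by apply: chain_forest_sub chS; apply: subsetDl.
have [|L0 pL0 L0E] := IH (S :\ p) _ chS'.
  by apply: leq_trans leSd; rewrite (cardsD1 p S) Sp.
set i := (val p).1; set j := (val p).2.
have pE : val p = (i, j) by apply: surjective_pairing.
have S'S : subrel (arc (S :\ p)) (arc S).
  by move=> x y /arcP[q]; rewrite inE => /andP[_ Sq] qE; rewrite (memP_arc _ qE).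
have /and3P[oS iS acS] := chS.
have aij : arc S i j by rewrite (memP_arc _ pE).
have naij : ~~ arc (S :\ p) i j by rewrite (memP_arc _ pE) !inE eqxx.
have [A LA Ai] := list_partition_ex pL0 i.
have [B LB Bj] := list_partition_ex pL0 j.
have [u AE] : exists u, A = rcons u i.
  case/splitPr: Ai LA => u [|k v] LA; first by exists u; rewrite cats1.
  have := @list_consec_arc _ pL0 _ i k LA; rewrite L0E => H.
  have aik : arc (S :\ p) i k by apply: H; apply/consecP; exists u, v.
  by case/negP: naij; rewrite (out_inj_arc oS aij (S'S _ _ aik)).
have [v BE] : exists v, B = j :: v.
  case/splitPr: Bj LB => w v; case/lastP: w => [|w k] LB; first by exists v.
  have := @list_consec_arc _ pL0 _ k j LB; rewrite L0E => H.
  have akj : arc (S :\ p) k j by apply: H; apply/consecP; exists w, v; rewrite cat_rcons.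
  by case/negP: naij; rewrite (in_inj_arc iS aij (S'S _ _ akj)).
(* In a common list, its first entry j would reach i, and i -> j would close a cycle. *)
have nAB : B != A.
  apply/eqP=> eBA; have := list_memE pL0 i LB Bj; rewrite eBA Ai => /esym.
  have con_S x y : connect (arc (S :\ p)) x y -> connect (arc S) x y.
    by apply: connect_sub => a b /S'S; apply: connect1.
  have := list_sorted pL0 LB; rewrite L0E {1}BE /= => pB _.
  have : connect (arc (S :\ p)) j i.
    have : i \in B by rewrite eBA.
    rewrite BE inE => /predU1P[eij|]; first by rewrite eij connect0.
    move=> vi; have tr : transitive (connect (arc (S :\ p))).
      by move=> a b c; apply: connect_trans.
    by have /allP/(_ i vi) := order_path_min tr pB.
  by move/con_S; apply/negP; apply: (acyclicP _ acS).
have pe1 := perm_to_rem LA.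
have LB' : B \in rem A L0.
  by move: LB; rewrite (perm_mem pe1) inE (negPf nAB).
set L1 := rem B (rem A L0).
have pe : perm_eq L0 [:: A, B & L1].
  by rewrite (perm_trans pe1) // perm_cons perm_to_rem.
exists ((A ++ B) :: L1).
  have [pf nL0] := andP pL0; apply/andP; split.
    rewrite -(permPr pf) perm_sym (permPl (perm_flatten pe)) /=.
    by rewrite catA perm_refl.
  move: nL0; rewrite (perm_mem pe) !inE !negb_or => /and3P[_ _ ->].
  by rewrite AE cat_rcons; case: (u).
have memC x y : ((x, y) \in flatten [seq consec t | t <- L0]) =
    ((x, y) \in consec A ++ consec B ++ flatten [seq consec t | t <- L1]).
  by rewrite (perm_mem (perm_flatten (perm_map _ pe))).
apply/setP=> q; rewrite -(setD1K Sp) -L0E !inE /=.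
rewrite [val q]surjective_pairing memC -surjective_pairing.
have -> : consec (A ++ B) = consec A ++ (i, j) :: consec B.
  by rewrite AE BE cat_rcons consec_cat.
rewrite !mem_cat inE -(inj_eq val_inj) pE.
by rewrite !orbA -orbA orbC -!orbA; do !bool_congr.
Qed.

End Lah.

(** * Sets of ordered subsets as list partitions *)

Section LahCount.

Variable m : nat.
Implicit Types (x : 'I_m) (c : ordered_subset m) (X : {set ordered_subset m}).
Implicit Types (s t : seq 'I_m) (L : seq (seq 'I_m)).

Local Notation lst c := (tval (tagged c)).

Lemma ordered_subset_inj c c' : lst c = lst c' -> c = c'.
Proof.
case: c c' => [l t] [l' t'] /= tt'; have ll' : l = l'.
  by apply: val_inj; rewrite /= -(size_tuple t) -(size_tuple t') tt'.
by subst l'; congr Tagged; apply: val_inj.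
Qed.

Lemma ordered_subset_ex s : uniq s -> exists c, lst c = s.
Proof.
move=> us; have lts : (size s < m.+1)%N by rewrite ltnS -[leqRHS]card_ord -(card_uniqP us) max_card.
by exists (@Tagged _ (Ordinal lts) (fun l : 'I_m.+1 => l.-tuple 'I_m) (in_tuple s)).
Qed.

Definition lah_lists X := [seq lst c | c <- enum X].

Lemma mem_lah_lists X c : (lst c \in lah_lists X) = (c \in X).
Proof. by rewrite /lah_lists (mem_map ordered_subset_inj) mem_enum. Qed.

Lemma lah_lists_partition X q : lah_partition q X ->
  list_partition (lah_lists X) /\ size (lah_lists X) = q.
Proof.
case/and3P=> /eqP cX /forall_inP okX /forallP onceX.
split; last by rewrite size_map -cardE.
(* Exactly one block contains x, and it has no repetition. *)
have cnt x : count_mem x (flatten (lah_lists X)) = 1%N.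
  rewrite -(eqP (onceX x)) count_flatten sumnE /lah_lists -map_comp big_map big_enum /=.
  rewrite -sum1dep_card big_mkcondr /=; apply: eq_bigr => c Xc.
  have /andP[_ uc] := okX c Xc.
  by rewrite (count_uniq_mem _ uc); case: (_ \in _).
have mem x : x \in flatten (lah_lists X) by rewrite -has_pred1 has_count cnt.
apply/andP; split.
  apply: uniq_perm => [||x]; rewrite ?enum_uniq ?mem_enum ?mem //.
  by apply: count_mem_uniq => x; rewrite cnt mem.
by apply/mapP=> -[c]; rewrite mem_enum => /okX /andP[+ _] e; rewrite -e.
Qed.

(** Only membership is compared, because [enum X] lists the blocks in an order of its own. The sizes
    agree since nonempty disjoint lists cannot repeat. *)
Lemma lah_of_lists L : list_partition L -> exists X,
  lah_partition (size L) X /\ lah_lists X =i L.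
Proof.
move=> pL; pose X : {set ordered_subset m} := [set c : ordered_subset m | lst c \in L]; exists X.
have memX : lah_lists X =i L.
  move=> s; apply/mapP/idP => [[c]|Ls]; first by rewrite mem_enum inE => Lc ->.
  have [c cE] := ordered_subset_ex (list_uniq pL Ls).
  by exists c; rewrite ?mem_enum ?inE ?cE.
have nL : [::] \notin L by case/andP: pL.
have uL : uniq L.
  have := list_partition_uniq pL; elim: (L) nL => //= s L' IH.
  rewrite inE negb_or cat_uniq => /andP[s0 nL'] /and3P[_ /hasPn dis uL'].
  rewrite IH // andbT; case: s s0 dis => // x s _ dis; apply/negP => Ls.
  have /dis : x \in flatten L' by apply/flattenP; exists (x :: s); rewrite ?mem_head.
  by rewrite mem_head.
split=> //; apply/and3P; split.
- rewrite cardE -(size_map (fun c => lst c)); apply/eqP/perm_size.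
  apply: uniq_perm => //; rewrite map_inj_uniq ?enum_uniq //.
  exact: ordered_subset_inj.
- apply/forall_inP=> c; rewrite inE => Lc; rewrite (list_uniq pL Lc) andbT.
  by case: (lst c) Lc => // Lc; case/negP: nL.
apply/forallP=> x; have [s Ls sx] := list_partition_ex pL x.
have [c cE] := ordered_subset_ex (list_uniq pL Ls).
apply/eqP; rewrite -(cards1 c); apply: eq_card => c'; rewrite !inE.
apply/andP/eqP => [[Lc' xc']|->]; last first.
  by split; [rewrite cE | have : x \in lst c by rewrite cE].
apply: ordered_subset_inj; rewrite cE.
exact: flatten_uniq_mem (list_partition_uniq pL) Lc' Ls xc' sx.
Qed.

(** Beyond the bound on q the truncated difference would be 0 and count the empty forest, although
    no partition has that many blocks. *)
Lemma lah_chain_forests q : (q <= m)%N -> lah m q = #|chain_forests m (m - q)%N|.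
Proof.
move=> le_qm; rewrite /lah.
have inj : {in [set X | lah_partition q X] &,
    injective (fun X => list_arcs (lah_lists X))}.
  move=> X Y; rewrite !inE => /lah_lists_partition[pX _] /lah_lists_partition[pY _] eXY.
  apply/setP=> c; rewrite -!mem_lah_lists; apply/idP/idP.
    exact: list_arcs_inj pX pY eXY _.
  exact: list_arcs_inj pY pX (esym eXY) _.
rewrite -(card_in_imset inj); apply: eq_card => S; rewrite inE.
apply/imsetP/andP => [[X + ->]|[chS /eqP cS]].
  rewrite inE => /lah_lists_partition[pX sX]; split; first exact: list_arcs_chain_forest.
  by rewrite -(eqn_add2r q) subnK // -{1}sX card_list_arcs.
have [L pL LE] := list_arcs_surj chS; have [X [lX XL]] := lah_of_lists pL.
have sL : size L = q.
  have := card_list_arcs pL; rewrite LE cS => /eqP.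
  by rewrite -[X in _ == X](subnK le_qm) eqn_add2l => /eqP.
exists X; first by rewrite inE -sL.
rewrite -LE; apply/setP=> p; rewrite !inE.
by apply/flatten_mapP/flatten_mapP => -[s sL' ps]; exists s; rewrite // -?XL // XL.
Qed.

End LahCount.

Lemma pvb_hilbert_lah a :
  pvb_hilbert a = \sum_(0 <= b < a.+1) (lah a b)%:R *: 'X^(a - b).
Proof.
rewrite big_mkord pvb_hilbert_forests.
rewrite (partition_big (fun X : {set pvb_index a} => inord (a - #|X|) : 'I_a.+1) predT) //=.
apply: eq_bigr => b _; rewrite lah_chain_forests -1?ltnS // scaler_nat -sumr_const.
have eX (X : {set pvb_index a}) : chain_forest X ->
    (inord (a - #|X|) == b) = (#|X| == a - b)%N.
  move=> /card_forest_le leX; rewrite -val_eqE /= inordK ?ltnS ?leq_subr //.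
  have leb : (b <= a)%N by rewrite -ltnS.
  by apply/eqP/eqP => [<-|->]; rewrite subKn.
apply: eq_big => [X|X /andP[chX]]; last by rewrite eX // => /eqP->.
by rewrite inE; case chX: (chain_forest X); rewrite //= eX.
Qed.

(** * Characters *)

(** The factor of a length that no cycle has. *)
Lemma pvb_hilbert0 : pvb_hilbert 0 = 1.
Proof.
rewrite pvb_hilbert_forests (big_pred1 set0) => [|X /=].
  by rewrite cards0 expr0.
have -> : X = set0 by apply/setP=> -[[[]]].
by rewrite chain_forest0 eqxx.
Qed.

Lemma card_porbit_cycle_lengths n (s : 'S_n) i : #|porbit s i| \in cycle_lengths s.
Proof.
apply/mapP; exists (porbit s i) => //.
by rewrite mem_enum; apply: imset_f.
Qed.

Lemma count_partition_of_mults r alpha i : (1 <= i <= r)%N ->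
  count_mem i (partition_of_mults r alpha) = alpha i.
Proof.
move=> ir; rewrite count_flatten -map_comp sumnE big_map.
rewrite (bigD1_seq i) ?iota_uniq ?mem_iota ?add1n ?ltnS //=.
rewrite count_nseq /= eqxx mul1n big1 ?addn0 // => j neji.
by rewrite count_nseq /= (negPf neji).
Qed.

Lemma pvb_char_homogeneous n (s : 'S_n) k a : (0 < k)%N ->
  has_cycle_type s (nseq a k) ->
  pvb_char s = pvb_hilbert a \Po (((-1) ^+ k.-1 * k%:R) *: 'X^k).
Proof.
move=> k0 st; rewrite (@pvb_char_inv _ _ [:: k]) => [|i].
  by rewrite inv_char_homogeneous // (seq.permP st) count_nseq /= eqxx mul1n.
have := card_porbit_cycle_lengths s i; rewrite (perm_mem st) mem_nseq inE.
by case/andP.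
Qed.

Theorem theorem7 :
  (forall (n : nat) (s : 'S_n) (k a : nat),
      (0 < k)%N -> (0 < a)%N ->
      n = (k * a)%N ->
      has_cycle_type s (nseq a k) ->
      pvb_char s = pvb_hilbert a \Po (((-1) ^+ k.-1 * k%:R) *: 'X^k)
      /\
      pvb_hilbert a \Po (((-1) ^+ k.-1 * k%:R) *: 'X^k) =
        \sum_(0 <= b < a.+1)
           ((lah a b)%:R * (-1) ^+ ((a - b) * k.-1) * k%:R ^+ (a - b))
             *: 'X^((a - b) * k))
  /\
  (forall (n : nat) (s : 'S_n) (r : nat) (alpha : nat -> nat),
      (0 < n)%N ->
      n = (\sum_(1 <= i < r.+1) i * alpha i)%N ->
      has_cycle_type s (partition_of_mults r alpha) ->
      ~ homogeneous (partition_of_mults r alpha) ->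
      forall t : (forall i : nat, 'S_(i * alpha i)),
        (forall i : nat, (1 <= i <= r)%N -> has_cycle_type (t i) (nseq (alpha i) i)) ->
        pvb_char s =
          \prod_(1 <= i < r.+1) (if alpha i == 0%N then 1 else pvb_char (t i))).

Proof.
split=> [n s k a k0 a0 nE st|n s r alpha n0 nE st nh t tP].
  split; first exact: pvb_char_homogeneous.
  rewrite pvb_hilbert_lah linear_sum; apply: eq_bigr => b _.
  rewrite linearZ /= comp_Xn_poly exprZn scalerA -exprM exprMn -exprM mulrA.
  by rewrite ![((_ - _) * _)%N]mulnC.
(* All lengths from 1 to r are listed, including those that no cycle has. *)
rewrite (@pvb_char_inv _ _ (iota 1 r)) => [|i]; last first.
  have := card_porbit_cycle_lengths s i; rewrite (perm_mem st).
  by case/flatten_mapP=> j jr; rewrite mem_nseq => /andP[_ /eqP->].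
rewrite inv_char_prod ?iota_uniq // /index_iota subn1 /=.
apply: eq_big_seq => i; rewrite mem_iota add1n ltnS => ir.
have i0 : (0 < i)%N by case/andP: ir.
(* The factor of s and the character of [t i] are compared through their common closed form. *)
rewrite inv_char_homogeneous // (seq.permP st) count_partition_of_mults //.
case: eqP => [->|_]; last by rewrite (pvb_char_homogeneous i0 (tP i ir)).
by rewrite pvb_hilbert0 -polyC1 comp_polyC.
Qed.
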